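(* Let $K$ be an infinite field of characteristic $p>0$ and let $n\ge r$ be positive integers. Let $\lambda,\mu\in\wedge^+(n,r)$ be such that $\lambda=(\lambda_1,\dots,\lambda_m)$, $\lambda_m\neq0$, $m\ge3$ and $\mu=(\mu_1,\mu_2)$. Define $d=\mu_1-\lambda_1$ and assume $0<d\le\lambda_2-\lambda_3$ and $\mu_2\le\lambda_1$. If $p$ divides all of the following integers \begin{enumerate} \item $R(\lambda_1-\mu_2+1,\,d)$, \item $R(\lambda_i+1,\,\lambda_{i+1})$, $i=2,\dots,m-1$, \item $R(\lambda_1-\lambda_2+d+1,\,d)$, \item $R(\lambda_2-d+1,\,\lambda_3)$, \end{enumerate} then the dimension of the $K$-vector space $\mathrm{Hom}_S(\Delta(\lambda),\Delta(\mu))$ is at least $2$.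
   Context: **Integers $R(x,y)$.** For positive integers $x,y$, $R(x,y)=\gcd\{\binom{x}{1},\binom{x+1}{2},\dots,\binom{x+y-1}{y}\}$. For a positive integer $x$, $R(x,0)=0$. **Partitions.** $\wedge^+(n,r)$ is the set of weakly decreasing sequences $(\lambda_1,\dots,\lambda_n)$ of nonnegative integers with sum $r$ (partitions of $r$ with at most $n$ parts); trailing zeros may be omitted. The transpose partition $\lambda^t$ of $\lambda$ is given by $\lambda^t_j=\#\{i:\lambda_i\ge j\}$. **Schur algebra and divided powers.** $S=S_K(n,r)$ is the Schur algebra; $S$-modules are the same as homogeneous polynomial representations of $GL_n(K)$ of degree $r$. $V=K^n$ is the natural module. $DV=\bigoplus_{i\ge0}D_iV$ is the divided power algebra of $V$ (the graded dual of the Hopf algebra $\mathrm{Sym}(V^* )$). It is a Hopf algebra with $v^{(i)}v^{(j)}=\binom{i+j}{j}v^{(i+j)}$ and $v^{(i)}\mapsto\sum_j v^{(j)}\otimes v^{(i-j)}$ under comultiplication, for $v\in V$. For a sequence $a=(a_1,\dots,a_k)$ of nonnegative integers, $D(a)=D_{a_1}V\otimes\cdots\otimes D_{a_k}V$ and $\Lambda(a)=\Lambda^{a_1}V\otimes\cdots\otimes\Lambda^{a_k}V$, with tensor products over $K$. **Weyl modules.** For $\lambda\in\wedge^+(n,r)$, the Weyl module $\Delta(\lambda)$ is the image of the $S$-map $d'_\lambda:D(\lambda)\to\Lambda(\lambda^t)$ of Akin–Buchsbaum–Weyman. This map is the composition of: (i) the tensor product over the rows $i$ of the iterated comultiplications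 $D_{\lambda_i}V\to V^{\otimes\lambda_i}$, whose tensor factors are indexed by the boxes of row $i$ of the diagram of $\lambda$ from left to right; (ii) the rearrangement of the tensor factors by columns (columns left to right, each column top to bottom); (iii) the tensor product over the columns $j$ of the multiplications $V^{\otimes\lambda^t_j}\to\Lambda^{\lambda^t_j}V$. *)

(* Defs.v *)
From HB Require Import structures.
From mathcomp Require Import all_boot all_fingroup all_algebra.

Set Implicit Arguments.
Unset Strict Implicit.
Unset Printing Implicit Defensive.

Import GRing.Theory.
Local Open Scope ring_scope.

(* R(x, y) = gcd {'C(x, 1), 'C(x + 1, 2), ..., 'C(x + y - 1, y)} for x > 0;
   the empty gcd is 0, so R(x, 0) = 0. *)
Definition Rgcd (x y : nat) : nat := \big[gcdn/0%N]_(k < y) 'C((x + k)%N, k.+1).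

(* The i-th part of a sequence, counted from 1 (and 0 beyond its length). *)
Definition part (a : seq nat) (i : nat) : nat := nth 0%N a i.-1.

(* The set wedge^+(n, r) of partitions of r with at most n parts. *)
Definition partitions (n r : nat) : pred (n.-tuple nat) :=
  [pred a : n.-tuple nat | sorted geq a && (sumn a == r)].
Arguments partitions : clear implicits.

Definition conj_part (a : seq nat) : seq nat :=
  mkseq (fun j => count (fun x => (j < x)%N) a) (part a 1).

Section FreeSpace.
Variable K : fieldType.

(* {ffun I -> K^o} is the K-space with basis I.  coefmap c is the linear map
   sending the basis vector i to \sum_j c j i * j. *)
Definition coefmap_fun (I J : finType) (c : J -> I -> K)
    (x : {ffun I -> K^o}) : {ffun J -> K^o} :=
  [ffun j => \sum_i c j i * x i].

Fact coefmap_fun_is_linear (I J : finType) (c : J -> I -> K) :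
  linear (coefmap_fun c).
Proof.
move=> a x y; apply/ffunP=> j; rewrite !ffunE scaler_sumr -big_split /=.
by apply: eq_bigr => i _; rewrite !ffunE mulrDr /GRing.scale /= mulrCA.
Qed.

HB.instance Definition _ (I J : finType) (c : J -> I -> K) :=
  GRing.isLinear.Build K {ffun I -> K^o} {ffun J -> K^o} *:%R
    (@coefmap_fun I J c) (@coefmap_fun_is_linear I J c).

Definition coefmap (I J : finType) (c : J -> I -> K) :
    'Hom({ffun I -> K^o}, {ffun J -> K^o}) :=
  linfun (coefmap_fun c).

Lemma coefmapE (I J : finType) (c : J -> I -> K) x j :
  coefmap c x j = \sum_i c j i * x i.
Proof. by rewrite lfunE ffunE. Qed.

(* The map f |-> f a - b f, whose kernel is the space of all f that
   intertwine a and b. *)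
Definition twist (U W : vectType K) (a : 'End(U)) (b : 'End(W))
    (f : 'Hom(U, W)) : 'Hom(U, W) := (f \o a)%VF - (b \o f)%VF.

Fact twist_is_linear (U W : vectType K) (a : 'End(U)) (b : 'End(W)) :
  linear (twist a b).
Proof.
move=> k f g; rewrite /twist comp_lfunDl comp_lfunDr -comp_lfunZl -comp_lfunZr.
by rewrite scalerBr opprD addrACA.
Qed.

HB.instance Definition _ (U W : vectType K) (a : 'End(U)) (b : 'End(W)) :=
  GRing.isLinear.Build K 'Hom(U, W) 'Hom(U, W) *:%R
    (@twist U W a b) (@twist_is_linear U W a b).

Definition intertwiners (U W : vectType K) (a : 'End(U)) (b : 'End(W)) :
    {vspace 'Hom(U, W)} := lker (linfun (twist a b)).

Lemma intertwinersP (U W : vectType K) (a : 'End(U)) (b : 'End(W)) f :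
  reflect (f \o a = b \o f)%VF (f \in intertwiners a b).
Proof. by rewrite memv_ker lfunE /= subr_eq0; apply: eqP. Qed.

End FreeSpace.

(* V = K^n has basis 'I_n, so the r-fold tensor power of V has as basis the
   words w : 'I_r -> 'I_n, the word w standing for
   e_(w 0) (x) ... (x) e_(w (r - 1)). *)
Notation word n r := {ffun 'I_r -> 'I_n}.
Notation tpow K n r := {ffun word n r -> K^o}.

Section Schur.
Variables (K : fieldType) (n r : nat).

Definition wact (w : word n r) (s : 'S_r) : word n r := [ffun k => w (s k)].

Definition place (s : 'S_r) : 'End(tpow K n r) :=
  coefmap (fun u w : word n r => (u == wact w s)%:R).

(* S_K(n, r) = End_{K S_r} (tpow K n r), as a space of endomorphisms. *)
Definition schur : {vspace 'End(tpow K n r)} :=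
  (\bigcap_(s : 'S_r) intertwiners (place s) (place s))%VS.

Lemma schurP (x : 'End(tpow K n r)) :
  reflect (forall s, x \o place s = place s \o x)%VF (x \in schur).
Proof.
rewrite memvE; apply: (iffP (@subv_bigcapP _ _ _ _ _ _)) => h s => [|_].
  by apply/intertwinersP; rewrite memvE h.
by rewrite -memvE; apply/intertwinersP.
Qed.

(* Slot number k of 'I_r, for a sequence a with sum r, lies in factor
   number blk a k of a tensor product of a_1-fold, a_2-fold, ... tensor powers,
   at position off a k there (all counted from 0). *)
Definition blk (a : seq nat) (k : 'I_r) : nat := reshape_index a k.
Definition off (a : seq nat) (k : 'I_r) : nat := reshape_offset a k.

Definition young (a : seq nat) (s : 'S_r) : bool :=
  [forall k, blk a (s k) == blk a k].

(* D(a): a word that increases weakly in each block stands for the tensor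
   product over the blocks of the monomials e_1^(c_1) ... e_n^(c_n), c_i being
   the number of letters i in the block. *)
Definition wincr (a : seq nat) (w : word n r) : bool :=
  [forall k, forall l,
    (blk a k == blk a l) && (k < l)%N ==> (w k <= w l)%N].
Definition Dbasis a := {w : word n r | wincr a w}.
Definition Dspace a := {ffun Dbasis a -> K^o}.

(* Lambda(a): a word that increases strictly in each block stands for the
   tensor product over the blocks of the exterior products of its letters. *)
Definition sincr (a : seq nat) (w : word n r) : bool :=
  [forall k, forall l,
    (blk a k == blk a l) && (k < l)%N ==> (w k < w l)%N].
Definition Lbasis a := {w : word n r | sincr a w}.
Definition Lspace a := {ffun Lbasis a -> K^o}.

(* Tensor product of the iterated comultiplications of DV: the component of
   degree (1, ..., 1) of the comultiplication of e_1^(c_1) ... e_n^(c_n) is the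
   sum of the distinct words with c_i letters i. *)
Definition comult a : 'Hom(Dspace a, tpow K n r) :=
  coefmap (fun (w : word n r) (T : Dbasis a) =>
    [exists s, young a s && (w == wact (val T) s)]%:R).

(* Tensor product of the multiplications of the exterior algebra: a word with
   a letter repeated in some block goes to 0, and any other word is uniquely
   C o s, with C increasing in each block and s permuting each block, and goes
   to the sign of s times C. *)
Definition mult a : 'Hom(tpow K n r, Lspace a) :=
  coefmap (fun (C : Lbasis a) (w : word n r) =>
    \sum_(s : 'S_r | young a s && (w == wact (val C) s)) (-1) ^+ s).

(* In the row reading of the diagram of a, slot k is the box in row blk a k and
   column off a k; in the column reading, slot l is the box in column
   blk a^t l and row off a^t l. *)
Definition same_box a (k l : 'I_r) : bool :=
  (blk a k == off (conj_part a) l) && (off a k == blk (conj_part a) l).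

Definition rearr a : 'End(tpow K n r) :=
  coefmap (fun u w : word n r =>
    [forall k, forall l, same_box a k l ==> (u l == w k)]%:R).

Definition dprime a : 'Hom(Dspace a, Lspace (conj_part a)) :=
  (mult (conj_part a) \o rearr a \o comult a)%VF.

Definition Weyl a : {vspace Lspace (conj_part a)} := limg (dprime a).

(* Lambda(a) is the quotient of the tensor power by the S-submodule
   lker (mult a), and S acts on it through this quotient: lsect a sends the
   basis vector C of Lambda(a) to the word C, and is a section of mult a. *)
Definition lsect a : 'Hom(Lspace a, tpow K n r) :=
  coefmap (fun (w : word n r) (C : Lbasis a) => (w == val C)%:R).

Definition Lact a (x : 'End(tpow K n r)) : 'End(Lspace a) :=
  (mult a \o x \o lsect a)%VF.

(* The action on the S-submodule Weyl a of Lambda(a^t): as Weyl a is stable,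
   vsproj only changes the type. *)
Definition Wact a (x : 'End(tpow K n r)) : 'End(subvs_of (Weyl a)) :=
  (linfun (vsproj (Weyl a)) \o Lact (conj_part a) x \o linfun vsval)%VF.

(* Hom_S(Delta(a), Delta(b)) *)
Definition HomS a b : {vspace 'Hom(subvs_of (Weyl a), subvs_of (Weyl b))} :=
  (\bigcap_(x <- vbasis schur) intertwiners (Wact a x) (Wact b x))%VS.

Lemma Wact_sum a (I : finType) (c : I -> K) (x : I -> 'End(tpow K n r)) :
  Wact a (\sum_i c i *: x i) = \sum_i c i *: Wact a (x i).
Proof.
apply/lfunP=> u; rewrite sum_lfunE.
under [RHS]eq_bigr do rewrite scale_lfunE !comp_lfunE.
rewrite !comp_lfunE sum_lfunE /= !linear_sum /=; apply: eq_bigr => i _.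
by rewrite scale_lfunE !linearZ.
Qed.

Lemma HomSP a b (f : 'Hom(subvs_of (Weyl a), subvs_of (Weyl b))) :
  reflect (forall x, x \in schur -> f \o Wact a x = Wact b x \o f)%VF
          (f \in HomS a b).
Proof.
rewrite memvE /HomS big_seq; apply: (iffP idP) => [/subvP h x xS | h].
- have h1 y : y \in vbasis schur -> (f \o Wact a y = Wact b y \o f)%VF.
    move=> yS; apply/intertwinersP; move: (h f (memv_line f)).
    by rewrite (big_rem y) //= yS memv_cap => /andP[].
  rewrite (coord_vbasis xS) !Wact_sum; apply/lfunP=> u.
  rewrite (comp_lfunE f) (comp_lfunE _ f) !sum_lfunE linear_sum.
  apply: eq_bigr => i _.
  have yS : (vbasis schur)`_i \in vbasis schur by rewrite mem_nth ?size_tuple.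
  have /lfunP/(_ u) := h1 _ yS; rewrite (comp_lfunE f) (comp_lfunE _ f) => E.
  by rewrite !scale_lfunE linearZ /= E.
- elim/big_rec: _ => [|y W yS IH]; first exact: subvf.
  rewrite subv_cap IH andbT -memvE; apply/intertwinersP/h.
  exact: vbasis_mem.
Qed.

End Schur.

(* Main.v *)
Require Import Defs.
From mathcomp Require Import all_boot all_fingroup all_algebra.
From mathcomp Require Import zify.

(* D(a) is the space of functions on words that are invariant under row
   permutations, and the kernel of d'_a consists of those killed by signed sums
   over column permutations.  Straightening presents the Weyl module: modulo
   Garnir elements every element of D(a) is supported on semistandard words,
   and d'_a is injective on those.  So a map D(lam) -> Delta(mu) that kills the
   Garnir elements factors through Delta(lam).

   A map D(lam) -> D(mu) is given by a family of colourings of the boxes of mu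
   with lam_j boxes of colour j; f goes to the sum of f over the family.  Two
   families give two maps: all colourings with colour 0 only in the top row,
   and those that moreover have colours >= 2 only in the bottom row.  On a
   Garnir element for rows i, i+1, every colouring of the remaining data is
   counted with a multiplicity.  If rows 0 and 1 are not both involved, it is a
   binomial coefficient divisible by p.  For rows 0 and 1, inclusion-exclusion
   and Vandermonde rewrite the multiplicities as sums over subsets B of the
   bottom row; the terms with B nonempty are symmetric under exchanging the two
   boxes of a column and die in the exterior power, and the term with B empty
   has coefficients 'C(lam_0 - b + q, q), divisible by p. *)

Set Implicit Arguments.
Unset Strict Implicit.
Unset Printing Implicit Defensive.

Import GRing.Theory.
Local Open Scope ring_scope.

(** * Boxes of a diagram *)

Section Boxes.
Variables (r : nat) (a : seq nat).
Hypothesis sum_a : sumn a = r.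
Implicit Types k l : 'I_r.

Lemma blk_lt_size k : (blk a k < size a)%N.
Proof. by apply: reshape_indexP; rewrite sum_a. Qed.

Lemma off_lt_nth k : (off a k < nth 0 a (blk a k))%N.
Proof. by apply: reshape_offsetP; rewrite sum_a. Qed.

Lemma box_inj k l : blk a k = blk a l -> off a k = off a l -> k = l.
Proof.
move=> hb ho; apply: val_inj.
rewrite /= -(reshape_indexK a k) -(reshape_indexK a l).
by rewrite /blk /off in hb ho; rewrite hb ho.
Qed.

Lemma box_exists i o : (o < nth 0 a i)%N ->
  exists k : 'I_r, blk a k = i /\ off a k = o.
Proof.
move=> ho; have lt_r : (flatten_index a i o < r)%N.
  by rewrite -sum_a flatten_indexP.
exists (Ordinal lt_r); rewrite /blk /off /=.
by rewrite flatten_indexKl ?flatten_indexKr.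
Qed.

Lemma off_ltn k l : blk a k = blk a l -> (off a k < off a l)%N = (k < l)%N.
Proof.
move=> hb; rewrite -[in RHS](reshape_indexK a k) -[in RHS](reshape_indexK a l).
by rewrite /blk in hb; rewrite hb /flatten_index ltn_add2l.
Qed.

Lemma box_val k : k = (sumn (take (blk a k) a) + off a k)%N :> nat.
Proof. by rewrite -[LHS](reshape_indexK a). Qed.

Lemma card_blk i : #|[set k : 'I_r | blk a k == i]| = nth 0%N a i.
Proof.
have [im|mi] := ltnP i (size a); last first.
  rewrite nth_default //; apply/eqP; rewrite cards_eq0; apply/eqP/setP=> k.
  by rewrite !inE; have := blk_lt_size k; case: eqP => // ->; rewrite ltnNge mi.
have lt_r (o : 'I_(nth 0%N a i)) : (flatten_index a i o < r)%N.
  by rewrite -sum_a flatten_indexP.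
pose g o := Ordinal (lt_r o).
rewrite -[RHS]card_ord -cardsT -(card_imset (f := g)).
  apply: eq_card => k; rewrite !inE; apply/eqP/imsetP => [hk|[o _ ->]].
    have ho : (off a k < nth 0 a i)%N by rewrite -hk off_lt_nth.
    exists (Ordinal ho); rewrite ?inE //; apply: val_inj => /=.
    by rewrite -[LHS](reshape_indexK a) -hk.
  by rewrite /blk /= flatten_indexKl.
move=> o o' /(congr1 (fun x => val x)) /= /eqP.
by rewrite /flatten_index eqn_add2l => /eqP/val_inj.
Qed.

End Boxes.

Lemma blk0_val (r : nat) (c : seq nat) (x : 'I_r) : sumn c = r ->
  (blk c x == 0%N) = (x < nth 0 c 0)%N.
Proof.
move=> sum_c; apply/eqP/idP => [hx|hx].
  by have := off_lt_nth sum_c x; rewrite {1}(box_val c x) hx take0.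
have [k [k0 ko]] := box_exists sum_c hx.
suff -> : x = k by [].
by apply: val_inj; rewrite /= (box_val c k) k0 ko take0.
Qed.

Lemma blk_ge2_val (r : nat) (a : seq nat) (x : 'I_r) : (2 <= blk a x)%N ->
  (nth 0 a 0 + nth 0 a 1 <= x)%N.
Proof.
move=> hx; rewrite (box_val a x); move: hx; move: (blk a x) (off a x) => j o.
by case: a => [|u [|v s]]; case: j => [|[|j]] //= _; lia.
Qed.

Lemma sorted_geq_nth (a : seq nat) i j :
  sorted geq a -> (i <= j)%N -> (nth 0 a j <= nth 0 a i)%N.
Proof.
move=> sa ij; have [ja|aj] := ltnP j (size a); last by rewrite nth_default.
have tr : transitive geq by move=> x y z /= h1 h2; exact: leq_trans h2 h1.
exact: (sorted_leq_nth tr leqnn 0%N sa i j (leq_ltn_trans ij ja) ja ij).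
Qed.

(** Since [a] decreases, its entries above [j] form an initial segment. This is what exchanges rows
    and columns of the diagram. *)
Lemma count_gt_nth (a : seq nat) i j : sorted geq a ->
  (i < count (fun x => j < x) a)%N = (j < nth 0 a i)%N.
Proof.
elim: a i => [|x a IH] i sa /=; first by rewrite nth_nil.
have tr : transitive geq by move=> u v w /= h1 h2; exact: leq_trans h2 h1.
have [jx|xj] := ltnP j x; first by case: i => [|i] /=;
  rewrite add1n ?jx // ltnS IH ?(path_sorted sa).
rewrite add0n (_ : count _ _ = 0%N).
  symmetry; apply/negbTE; rewrite -leqNgt.
  exact: leq_trans (sorted_geq_nth sa (leq0n i)) xj.
apply/eqP; rewrite -leqn0 leqNgt -has_count; apply/hasPn=> y ya.
by rewrite -leqNgt (leq_trans _ xj) //; move: sa; rewrite /= path_sortedE // =>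
  /andP[/allP/(_ _ ya)].
Qed.

Lemma nth_conj_part (a : seq nat) j : sorted geq a ->
  nth 0%N (conj_part a) j = count (fun x => j < x)%N a.
Proof.
move=> sa; rewrite /conj_part /part /=.
have [jp|pj] := ltnP j (nth 0 a 0); first by rewrite nth_mkseq.
rewrite nth_default ?size_mkseq //; apply/esym/eqP.
by rewrite -leqn0 leqNgt count_gt_nth // -leqNgt.
Qed.

(** Double counting of the boxes, by columns and by rows. *)
Lemma sumn_conj_part (a : seq nat) : sorted geq a -> sumn (conj_part a) = sumn a.
Proof.
move=> sa; rewrite /conj_part sumnE big_map /=.
have cntE (P : pred nat) s : count P s = (\sum_(x <- s) P x)%N.
  by rewrite -sum1_count big_mkcond; apply: eq_bigr => x _; case: (P x).
rewrite (eq_bigr (fun j => \sum_(x <- a) (j < x))%N) => [|j _]; last exact: cntE.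
rewrite exchange_big /= sumnE !big_seq; apply: eq_bigr => x xa.
rewrite -(cntE (fun j => j < x)%N) /part /=.
have xle : (x <= nth 0 a 0)%N.
  by rewrite -(nth_index 0%N xa) sorted_geq_nth.
rewrite -(subnKC xle) iotaD count_cat add0n.
rewrite (eq_in_count (a2 := predT)) => [|y]; last by rewrite mem_iota => /andP[_ /= ->].
rewrite count_predT size_iota (eq_in_count (a2 := pred0)) ?count_pred0 ?addn0 // => y.
by rewrite mem_iota => /andP[h _]; rewrite ltnNge h.
Qed.

(** * Permutations of the slots of a word *)

Section Relabel.
Variables (r : nat) (T : Type).
Implicit Types (c : {ffun 'I_r -> T}) (s t : 'S_r).

(** The formula of [wact] for letters of any type, so that words and colourings are permuted
    alike. *)
Definition rp c s : {ffun 'I_r -> T} := [ffun k => c (s k)].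

Lemma rpE c s k : rp c s k = c (s k). Proof. by rewrite ffunE. Qed.

Lemma rp1 c : rp c 1%g = c.
Proof. by apply/ffunP=> k; rewrite rpE perm1. Qed.

Lemma rpM c s t : rp (rp c s) t = rp c (t * s)%g.
Proof. by apply/ffunP=> k; rewrite !rpE permM. Qed.

Lemma rpK s : cancel (rp^~ s) (rp^~ s^-1%g).
Proof. by move=> c; rewrite rpM mulVg rp1. Qed.

Lemma rpVK s : cancel (rp^~ s^-1%g) (rp^~ s).
Proof. by move=> c; rewrite rpM mulgV rp1. Qed.

Lemma rp_inj s : injective (rp^~ s).
Proof. exact: can_inj (rpK s). Qed.

Lemma rp_tperm c k l : c k = c l -> rp c (tperm k l) = c.
Proof.
by move=> ckl; apply/ffunP=> j; rewrite rpE; case: tpermP => [->|->|].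
Qed.

End Relabel.

(** * Block-preserving permutations and sorted words *)

Section Keeps.
Variables (r : nat) (kap : 'I_r -> nat).
Implicit Types s t : 'S_r.

(** For [kap] equal to [blk a] these permutations form the row group of the diagram, for [off a] its
    column group. *)
Definition keeps s : bool := [forall k, kap (s k) == kap k].

Lemma keepsP s : reflect (forall k, kap (s k) = kap k) (keeps s).
Proof. exact: 'forall_eqP. Qed.

Lemma keeps1 : keeps 1%g.
Proof. by apply/keepsP=> k; rewrite perm1. Qed.

Lemma keepsM s t : keeps s -> keeps t -> keeps (s * t)%g.
Proof. by move=> /keepsP hs /keepsP ht; apply/keepsP=> k; rewrite permM ht hs. Qed.

Lemma keepsV s : keeps s -> keeps s^-1%g.
Proof. by move=> /keepsP hs; apply/keepsP=> k; rewrite -hs permKV. Qed.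

Lemma keeps_tperm k l : kap k = kap l -> keeps (tperm k l).
Proof. by move=> kl; apply/keepsP=> j; case: tpermP => [->|->|]. Qed.

Lemma keepsMl s t : keeps s -> keeps (s * t)%g = keeps t.
Proof.
move=> hs; apply/idP/idP => h; last exact: keepsM.
by rewrite -(mulKg s t); apply: keepsM => //; apply: keepsV.
Qed.

Lemma keepsMr s t : keeps s -> keeps (t * s)%g = keeps t.
Proof.
move=> hs; apply/idP/idP => h; last exact: keepsM.
by rewrite -(mulgK s t); apply: keepsM => //; apply: keepsV.
Qed.

Variable n : nat.
Implicit Types w : word n r.

Definition sortedw w := forall k l, kap k = kap l -> (k < l)%N -> (w k <= w l)%N.

Definition strictw w := forall k l, kap k = kap l -> (k < l)%N -> (w k < w l)%N.

Lemma strictwW w : strictw w -> sortedw w.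
Proof. by move=> hw k l hk ltkl; apply/ltnW/hw. Qed.

Lemma strictw_fix w s : strictw w -> keeps s -> rp w s = w -> s = 1%g.
Proof.
move=> hw /keepsP hs e; apply/permP=> k; rewrite perm1; apply: val_inj => /=.
have ek : w (s k) = w k by rewrite -[in RHS]e rpE.
by case: (ltngtP (s k) k) => // /hw; rewrite hs ek ltnn => /(_ erefl).
Qed.

Section Weight.
Variable h : 'I_r -> nat.
Hypothesis h_incr : forall k l, kap k = kap l -> (k < l)%N -> (h k < h l)%N.
Let wt w := (\sum_k h k * w k)%N.

(* Exchanging two letters that stand in the wrong order raises the weight. *)
Lemma sortedw_max w s : keeps s ->
  (forall t, keeps t -> wt (rp w t) <= wt (rp w s))%N -> sortedw (rp w s).
Proof.
move=> hs hmax k l kl ltkl; rewrite leqNgt; apply/negP => gt_kl.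
have := hmax (tperm k l * s)%g; rewrite keepsM ?keeps_tperm // => /(_ isT).
have nkl : k != l by apply: contraTneq ltkl => ->; rewrite ltnn.
have hkl := h_incr kl ltkl.
rewrite leqNgt => /negP; apply; rewrite -rpM /wt.
have split_kl (F : 'I_r -> nat) : (\sum_j F j =
    F k + F l + \sum_(j | (j != k) && (j != l)) F j)%N.
  by rewrite (bigD1 k) //= (bigD1 l) /= ?addnA // eq_sym.
rewrite !split_kl ![rp (rp _ _) _ _]rpE tpermL tpermR.
rewrite [X in (_ < _ + X)%N](eq_bigr (fun j : 'I_r => h j * rp w s j))%N.
  by rewrite ltn_add2r; nia.
by move=> j /andP[jk jl]; rewrite rpE tpermD // eq_sym.
Qed.

Lemma sortedw_argmax w : exists s, [/\ keeps s, sortedw (rp w s) &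
  forall t, keeps t -> (wt (rp w t) <= wt (rp w s))%N].
Proof.
have [s hs hmax] := arg_maxnP (fun s => wt (rp w s)) keeps1.
by exists s; split=> //; apply: sortedw_max.
Qed.

End Weight.

Lemma sortedw_exists w : exists2 s, keeps s & sortedw (rp w s).
Proof.
by have [//|s []] := @sortedw_argmax (fun k => val k) _ w; exists s.
Qed.

(** Within each block both words list the same multiset of letters in weakly increasing order, and
    such a list is unique. *)
Lemma sortedw_uniq w s : sortedw w -> keeps s -> sortedw (rp w s) -> rp w s = w.
Proof.
move=> sw ks sws; apply/ffunP => k.
pose E := [seq j <- enum 'I_r | kap j == kap k].
have sortE v : sortedw v -> sorted leq (map (fun j => val (v j)) E).
  move=> sv; rewrite sorted_map.
  have : sorted (fun i j : 'I_r => (i < j)%N) E.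
    apply: sorted_filter => [x y z|]; first exact: ltn_trans.
    by rewrite -(@sorted_map _ _ val ltn) val_enum_ord iota_ltn_sorted.
  apply: (@sub_in_sorted _ (fun j => kap j == kap k)) => [i j|].
    by move=> /eqP hi /eqP hj /=; apply: sv; rewrite hi hj.
  by apply/allP=> j; rewrite mem_filter => /andP[].
have memE j : (j \in E) = (kap j == kap k) by rewrite mem_filter mem_enum andbT.
have uniqE : uniq E by rewrite filter_uniq // enum_uniq.
have permE : perm_eq (map s E) E.
  apply: uniq_perm => //; first by rewrite map_inj_uniq //; exact: perm_inj.
  move=> j; rewrite -{1}(permKV s j) mem_map; last exact: perm_inj.
  by rewrite !memE; move/keepsP: (keepsV ks) => ->.
have eqE : map (fun j => val (rp w s j)) E = map (fun j => val (w j)) E.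
  apply: (sorted_eq leq_trans anti_leq (sortE _ sws) (sortE _ sw)).
  rewrite (eq_map (g := (fun j => val (w j)) \o s)) => [|j]; last by rewrite /= rpE.
  by rewrite map_comp perm_map.
apply: val_inj; move/eq_in_map: eqE => /(_ k); apply.
by rewrite memE.
Qed.

(** A heaviest arrangement is sorted, hence equal to [w]; so [w] already has maximal weight, and
    anything as heavy is sorted too. This drives the leading term argument of [dprime_sst_inj]. *)
Lemma sortedw_heaviest (h : 'I_r -> nat) w s :
  (forall k l, kap k = kap l -> (k < l)%N -> (h k < h l)%N) ->
  sortedw w -> keeps s -> (\sum_k h k * w k <= \sum_k h k * rp w s k)%N ->
  rp w s = w.
Proof.
move=> h_incr sw ks le_w; have [t [kt st tmax]] := sortedw_argmax h_incr w.
apply: sortedw_uniq => //; apply: (sortedw_max h_incr) => // u /tmax.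
by rewrite (sortedw_uniq sw kt st) => /leq_trans; apply.
Qed.

End Keeps.

(** * Signed column sums *)

Section Words.
Variables (K : fieldType) (n r : nat).
Implicit Types (f g : tpow K n r) (w : word n r) (s : 'S_r).

Section Altsum.
Variable kap : 'I_r -> nat.

Definition altsum f w : K :=
  \sum_(s : 'S_r | keeps kap s) (-1) ^+ s * f (rp w s).

(** The parity-reversing bijection [phi] matches odd terms with even ones. Cancelling them termwise
    needs no division by 2, so characteristic 2 is covered. *)
Lemma signed_sum_eq0 (P : pred 'S_r) (phi : 'S_r -> 'S_r) (F : 'S_r -> K) :
  bijective phi -> (forall s, P (phi s) = P s) ->
  (forall s, odd_perm (phi s) = ~~ odd_perm s) ->
  (forall s, F (phi s) = F s) -> \sum_(s | P s) (-1) ^+ s * F s = 0.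
Proof.
move=> phi_bij hP hodd hF; rewrite (bigID (@odd_perm _)) /=.
rewrite (reindex phi) /=; last exact: onW_bij.
rewrite (eq_bigl (fun s => P s && ~~ odd_perm s)) => [|s]; last by rewrite hP hodd.
rewrite -big_split /= big1 // => s /andP[_ es].
by rewrite hodd hF (negbTE es) /= expr1 expr0 mulN1r mul1r addNr.
Qed.

Lemma altsum_sym_eq0 f k l : k != l -> kap k = kap l ->
  (forall w, f (rp w (tperm k l)) = f w) -> forall w, altsum f w = 0.
Proof.
move=> kl hkap hf w; apply: (@signed_sum_eq0 _ (fun s => tperm k l * s)%g).
- by exists (fun s => tperm k l * s)%g => s; rewrite mulgA tperm2 mul1g.
- by move=> s; rewrite keepsMl // keeps_tperm.
- by move=> s; rewrite odd_mul_tperm kl.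
- by move=> s; rewrite -rpM hf.
Qed.

Lemma altsum_repeat_eq0 f w k l : k != l -> kap k = kap l -> w k = w l ->
  altsum f w = 0.
Proof.
move=> kl hkap hw; apply: (@signed_sum_eq0 _ (fun s => s * tperm k l)%g).
- by exists (fun s => s * tperm k l)%g => s; rewrite -mulgA tperm2 mulg1.
- by move=> s; rewrite keepsMr // keeps_tperm.
- by move=> s; rewrite odd_permM odd_tperm kl addbT.
- by move=> s; rewrite -rpM rp_tperm.
Qed.

Lemma altsum_rp f w s : keeps kap s ->
  altsum f (rp w s) = (-1) ^+ s * altsum f w.
Proof.
move=> hs; rewrite /altsum mulr_sumr [RHS](reindex_inj (mulIg s)) /=.
apply: eq_big => [t|t _]; first by rewrite keepsMr.
by rewrite rpM odd_permM signr_addb mulrA mulrCA -expr2 sqrr_sign mulr1.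
Qed.

(** Sorting the blocks changes the sum only by a sign, and a repeated letter makes it vanish. *)
Lemma altsum_eq0P f :
  (forall w, strictw kap w -> altsum f w = 0) -> forall w, altsum f w = 0.
Proof.
move=> hf w; have [s hs sw] := sortedw_exists kap w.
have nz : (-1) ^+ s != 0 :> K by rewrite signr_eq0.
apply: (mulfI nz); rewrite mulr0 -altsum_rp //.
pose bad := [pred kl : 'I_r * 'I_r | [&& kap kl.1 == kap kl.2, (kl.1 < kl.2)%N
  & rp w s kl.1 == rp w s kl.2]].
have [[k l] /and3P[/= /eqP hk ltkl /eqP e]|nobad] := pickP bad.
  by apply: altsum_repeat_eq0 hk e; apply: contraTneq ltkl => ->; rewrite ltnn.
apply: hf => k l hk ltkl; rewrite ltn_neqAle sw // andbT.
by have := nobad (k, l); rewrite /= hk ltkl eqxx /= => /negbT.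
Qed.

End Altsum.

Lemma placeE s f w : place K n s f w = f (rp w s^-1%g).
Proof.
rewrite coefmapE (bigD1 (rp w s^-1%g)) //= big1 ?addr0 => [|u hu].
  by rewrite (_ : wact _ s = w) ?eqxx ?mul1r //; exact: rpVK.
case: eqP => [hw|]; last by rewrite mul0r.
by case/eqP: hu; rewrite hw; symmetry; exact: rpK.
Qed.

Section Shape.
Variable a : seq nat.

Lemma mult_altsum f C : mult K n r a f C = altsum (blk a) f (val C).
Proof.
rewrite coefmapE; under eq_bigr do rewrite mulr_suml.
rewrite (exchange_big_dep (fun s => keeps (blk a) s)) => [|w s _ /andP[]] //=.
apply: eq_bigr => s hs; rewrite (bigD1 (rp (val C) s)) ?eqxx ?andbT //= big1 ?addr0 //.
by move=> w /andP[/andP[_ /eqP ->]]; rewrite eqxx.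
Qed.

Lemma sincrP w : reflect (strictw (blk a) w) (sincr a w).
Proof.
apply: (iffP forallP) => h k => [l hk ltkl|].
  by move/forallP/(_ l)/implyP: (h k); apply; rewrite hk eqxx.
by apply/forallP=> l; apply/implyP=> /andP[/eqP hk ltkl]; apply: h.
Qed.

Lemma mult_eq0P f : reflect (forall w, altsum (blk a) f w = 0) (mult K n r a f == 0).
Proof.
apply: (iffP eqP) => [h|h]; last by apply/ffunP=> C; rewrite mult_altsum h ffunE.
apply: altsum_eq0P => w /sincrP siw.
have /ffunP/(_ (Sub w siw)) := h.
by rewrite mult_altsum ffunE.
Qed.

Lemma wincrP w : reflect (sortedw (blk a) w) (wincr a w).
Proof.
apply: (iffP forallP) => h k => [l hk ltkl|].
  by move/forallP/(_ l)/implyP: (h k); apply; rewrite hk eqxx.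
by apply/forallP=> l; apply/implyP=> /andP[/eqP hk ltkl]; apply: h.
Qed.

Definition yinv f := forall w s, keeps (blk a) s -> f (rp w s) = f w.

(** Row-sorted representatives are unique, so [T] is the only basis element whose row orbit contains
    this word. *)
Lemma comultE (x : Dspace K n r a) (T : Dbasis n r a) s : keeps (blk a) s ->
  comult K n r a x (rp (val T) s) = x T.
Proof.
move=> hs; rewrite coefmapE (bigD1 T) //= big1 ?addr0 => [|T' neT].
  rewrite (_ : [exists _, _]) ?mul1r //; apply/existsP; exists s.
  by rewrite eqxx andbT.
case: existsP => [[t /andP[ht /eqP e]]|]; last by rewrite mul0r.
case/eqP: neT; apply: val_inj => /=.
have e' : val T' = rp (val T) (t^-1 * s)%g.
  by rewrite -rpM e; symmetry; exact: rpK.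
rewrite e'; apply: (sortedw_uniq (kap := blk a)).
- exact/wincrP/(valP T).
- exact: keepsM (keepsV ht) hs.
- by rewrite -e'; exact/wincrP/(valP T').
Qed.

Lemma comult_yinv x : yinv (comult K n r a x).
Proof.
move=> w s hs; have [t ht sw] := sortedw_exists (blk a) w.
have wT : wincr a (rp w t) by apply/wincrP.
pose T : Dbasis n r a := Sub (rp w t) wT.
have -> : w = rp (val T) t^-1%g by rewrite /= rpK.
by rewrite rpM !comultE //; [exact: keepsV | exact: keepsM hs (keepsV ht)].
Qed.

Definition restrD f : Dspace K n r a := [ffun T => f (val T)].

(** A row-invariant function is determined by its values on row-sorted words. Together with
    [comult_yinv] this identifies D(a) with the row-invariant tensors. *)
Lemma restrDK f : yinv f -> comult K n r a (restrD f) = f.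
Proof.
move=> hf; apply/ffunP=> w; have [t ht sw] := sortedw_exists (blk a) w.
have wT : wincr a (rp w t) by apply/wincrP.
pose T : Dbasis n r a := Sub (rp w t) wT.
have -> : w = rp (val T) t^-1%g by rewrite /= rpK.
by rewrite comultE ?ffunE ?hf //; exact: keepsV.
Qed.

End Shape.

Section Transpose.
Variable a : seq nat.
Hypotheses (sum_a : sumn a = r) (sorted_a : sorted geq a).

Lemma box_transpose : exists p : 'S_r, forall k,
  blk (conj_part a) (p k) = off a k /\ off (conj_part a) (p k) = blk a k.
Proof.
have sum_c : sumn (conj_part a) = r by rewrite sumn_conj_part.
have ex (k : 'I_r) : exists l : 'I_r,
    blk (conj_part a) l = off a k /\ off (conj_part a) l = blk a k.
  by apply: (box_exists sum_c); rewrite nth_conj_part // count_gt_nth // off_lt_nth.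
have [p hp] := fin_all_exists ex.
have p_inj : injective p.
  move=> k l e; have [hb ho] := hp k; have [hb' ho'] := hp l.
  by apply: (box_inj (a := a)); rewrite -?hb -?hb' -?ho -?ho' e.
by exists (perm p_inj) => k; rewrite permE.
Qed.

Lemma rearr_rp : exists2 p : 'S_r,
  forall k, blk (conj_part a) (p k) = off a k &
  forall f w, rearr K n r a f w = f (rp w p).
Proof.
have [p hp] := box_transpose; exists p => [k|f w]; first by case: (hp k).
rewrite coefmapE (bigD1 (rp w p)) //= big1 ?addr0 => [|u hu].
  rewrite (_ : [forall k, _]) ?mul1r //.
  apply/forallP=> k; apply/forallP=> l; apply/implyP=> /andP[/eqP h1 /eqP h2].
  rewrite rpE (_ : l = p k) //; apply: (box_inj (a := conj_part a)).
    by rewrite -h2; case: (hp k).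
  by rewrite -h1; case: (hp k).
case: forallP => [h|]; last by rewrite mul0r.
case/eqP: hu; apply/ffunP=> k; rewrite rpE.
have /forallP/(_ (p k))/implyP/(_ _)/eqP -> // := h k.
by rewrite /same_box; case: (hp k) => -> ->; rewrite !eqxx.
Qed.

(** Conjugation by the change of reading order carries the column group of one reading to that of
    the other and preserves signs. From here on only the row reading is needed. *)
Lemma altsum_rearr : exists p : 'S_r, forall f w,
  altsum (blk (conj_part a)) (rearr K n r a f) w = altsum (off a) f (rp w p).
Proof.
have [p hp hf] := rearr_rp; exists p => f w.
rewrite /altsum (reindex_inj (conjg_inj p)) /=.
apply: eq_big => [s|s _].
  apply/keepsP/keepsP => h k.
    by have := h (p k); rewrite conjgE !permM permK !hp.
  by rewrite conjgE !permM hp h -hp permKV.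
by rewrite odd_permJ hf !rpM conjgE mulgA mulgA mulgV mul1g.
Qed.

Lemma mult_rearr_eq0P f :
  reflect (forall w, altsum (off a) f w = 0)
          (mult K n r (conj_part a) (rearr K n r a f) == 0).
Proof.
apply: (equivP (mult_eq0P (conj_part a) (rearr K n r a f))); have [p hp] :=
  altsum_rearr.
split=> h w; last by rewrite hp h.
by rewrite -(rpVK p w) -hp h.
Qed.

End Transpose.
End Words.

(** * Homomorphisms induced by place permutations *)

Section SchurAction.
Variables (K : fieldType) (n r : nat).
Implicit Types (f g : tpow K n r) (w : word n r) (s : 'S_r).
Implicit Types x : 'End(tpow K n r).

Lemma schur_place x f s : x \in schur K n r -> x (place K n s f) = place K n s (x f).
Proof. by move=> /schurP/(_ s)/lfunP/(_ f); rewrite !comp_lfunE. Qed.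

Lemma place_rp f s w : place K n s^-1%g f w = f (rp w s).
Proof. by rewrite placeE invgK. Qed.

(** The signed sum is a combination of place permutations, and these commute with the Schur
    algebra. *)
Lemma schur_altsum (kap : 'I_r -> nat) x f : x \in schur K n r ->
  (forall w, altsum kap f w = 0) -> forall w, altsum kap (x f) w = 0.
Proof.
move=> xS hf w.
pose A : tpow K n r -> tpow K n r :=
  fun g => \sum_(s | keeps kap s) (-1) ^+ s *: place K n s^-1%g g.
have AE g u : A g u = altsum kap g u.
  by rewrite sum_ffunE; apply: eq_bigr => s _; rewrite ffunE place_rp.
have A0 : A f = 0 by apply/ffunP=> u; rewrite AE hf ffunE.
rewrite -AE (_ : A (x f) = x (A f)); first by rewrite A0 linear0 ffunE.
rewrite linear_sum; apply: eq_bigr => s _.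
by rewrite linearZ /= schur_place.
Qed.

Lemma schur_yinv (a : seq nat) x f : x \in schur K n r -> yinv a f -> yinv a (x f).
Proof.
move=> xS hf w s hs; rewrite -place_rp -schur_place //; congr (x _ _).
by apply/ffunP=> u; rewrite place_rp hf.
Qed.

Lemma lsectE a (y : Lspace K n r a) w :
  lsect K n r a y w = if insub w is Some C then y C else 0.
Proof.
rewrite coefmapE; case: insubP => [C _ wC|hw].
  rewrite (bigD1 C) //= wC eqxx mul1r big1 ?addr0 // => C' neC.
  by rewrite -wC (inj_eq val_inj) eq_sym (negbTE neC) mul0r.
apply: big1 => C _; case: eqP => [wC|]; last by rewrite mul0r.
by move: hw; rewrite wC (valP C).
Qed.

(** Only the identity contributes: a block permutation taking a strict word to a strict word fixes
    it, hence is trivial. *)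
Lemma mult_lsect a (y : Lspace K n r a) : mult K n r a (lsect K n r a y) = y.
Proof.
apply/ffunP=> C; rewrite mult_altsum /altsum (bigD1 1%g) ?keeps1 //= rp1 lsectE valK.
rewrite odd_perm1 mul1r big1 ?addr0 // => s /andP[hs ns1].
rewrite lsectE; case: insubP => [C' _ eC'|]; last by rewrite mulr0.
have sC (D : Lbasis n r a) : strictw (blk a) (val D) by apply/sincrP/(valP D).
case/eqP: ns1; apply: (strictw_fix (sC C) hs).
apply: (sortedw_uniq _ hs); first exact/strictwW/sC.
by rewrite -eC'; exact/strictwW/sC.
Qed.

(** By [schur_altsum] the kernel of [mult] is stable under [x], so the section in [Lact] may be
    replaced by any other lift. *)
Lemma Lact_mult a x f : x \in schur K n r ->
  Lact a x (mult K n r a f) = mult K n r a (x f).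
Proof.
move=> xS; rewrite /Lact !comp_lfunE; apply/eqP.
rewrite -subr_eq0 -linearB -linearB; apply/mult_eq0P; apply: schur_altsum => //.
by apply/mult_eq0P; rewrite linearB /= mult_lsect subrr.
Qed.

Section Hom.
Variables (a b : seq nat).
Hypotheses (sum_a : sumn a = r) (sorted_a : sorted geq a).
Hypotheses (sum_b : sumn b = r) (sorted_b : sorted geq b).

Lemma schur_rearr x f : x \in schur K n r ->
  x (rearr K n r a f) = rearr K n r a (x f).
Proof.
move=> xS; have [p _ hp] := rearr_rp K n sum_a sorted_a.
have rE g : rearr K n r a g = place K n p^-1%g g.
  by apply/ffunP=> w; rewrite hp place_rp.
by rewrite !rE schur_place.
Qed.

Lemma dprimeE (x : Dspace K n r a) :
  dprime K n r a x = mult K n r (conj_part a) (rearr K n r a (comult K n r a x)).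
Proof. by rewrite !comp_lfunE. Qed.

Lemma dprime_Weyl (x : Dspace K n r a) : dprime K n r a x \in Weyl K n r a.
Proof. by rewrite memv_img ?memvf. Qed.

Lemma Lact_dprime x y : x \in schur K n r ->
  Lact (conj_part a) x (dprime K n r a y) =
  dprime K n r a (restrD a (x (comult K n r a y))).
Proof.
move=> xS; rewrite !dprimeE Lact_mult // schur_rearr // restrDK //.
exact/schur_yinv/comult_yinv.
Qed.

Lemma val_Wact x (u : subvs_of (Weyl K n r a)) :
  Lact (conj_part a) x (vsval u) \in Weyl K n r a ->
  vsval (Wact a x u) = Lact (conj_part a) x (vsval u).
Proof.
rewrite /Wact; move: (Lact _ x) => L hL.
by rewrite !comp_lfunE !lfunE /= vsprojK.
Qed.

End Hom.

(** * From maps on D(a) to homomorphisms of Weyl modules *)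

Section HomConstruction.
Variables (a b : seq nat).
Hypotheses (sum_a : sumn a = r) (sorted_a : sorted geq a).
Hypotheses (sum_b : sumn b = r) (sorted_b : sorted geq b).
Variable theta : 'End(tpow K n r).
Hypothesis theta_schur : forall x f, x \in schur K n r -> theta (x f) = x (theta f).
Hypothesis theta_yinv : forall f, yinv a f -> yinv b (theta f).

Definition induced : 'Hom(Dspace K n r a, Lspace K n r (conj_part b)) :=
  (mult K n r (conj_part b) \o rearr K n r b \o theta \o comult K n r a)%VF.

Lemma inducedE (x : Dspace K n r a) : induced x =
  mult K n r (conj_part b) (rearr K n r b (theta (comult K n r a x))).
Proof. by rewrite !comp_lfunE. Qed.

Hypothesis theta_ker : forall x : Dspace K n r a, dprime K n r a x = 0 -> induced x = 0.

Lemma induced_Weyl (x : Dspace K n r a) : induced x \in Weyl K n r b.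
Proof.
rewrite inducedE -(restrDK (theta_yinv (comult_yinv x))).
by rewrite -dprimeE dprime_Weyl.
Qed.

(** The inverse of [dprime] merely selects a preimage; [theta_ker] makes the value independent of
    it, as [whomE] records. *)
Definition whom : 'Hom(subvs_of (Weyl K n r a), subvs_of (Weyl K n r b)) :=
  (linfun (vsproj (Weyl K n r b)) \o induced \o (dprime K n r a)^-1 \o
     linfun vsval)%VF.

Lemma whomE (u : subvs_of (Weyl K n r a)) (x : Dspace K n r a) :
  vsval u = dprime K n r a x -> vsval (whom u) = induced x.
Proof.
move=> hu; pose y := ((dprime K n r a)^-1)%VF (vsval u).
have -> : vsval (whom u) = induced y.
  rewrite /whom /y; move: induced induced_Weyl => I IW.
  by rewrite !comp_lfunE !lfunE /= vsprojK.
apply/eqP; rewrite -subr_eq0 -linearB; apply/eqP/theta_ker.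
by rewrite linearB /= /y hu limg_lfunVK ?subrr // memv_img ?memvf.
Qed.

Lemma whom_HomS : whom \in HomS K n r a b.
Proof.
apply/HomSP=> x xS; apply/lfunP=> u.
rewrite (comp_lfunE whom) (comp_lfunE _ whom); apply: val_inj.
have [y _ hu] := memv_imgP (subvsP u).
have hxu : vsval (Wact a x u) = dprime K n r a (restrD a (x (comult K n r a y))).
  by rewrite -Lact_dprime // -hu val_Wact // hu Lact_dprime // dprime_Weyl.
have hind : induced (restrD a (x (comult K n r a y))) =
    Lact (conj_part b) x (induced y).
  rewrite !inducedE Lact_mult // schur_rearr // -(theta_schur _ xS) restrDK //.
  exact/schur_yinv/comult_yinv.
rewrite [LHS](whomE hxu) hind -(whomE hu); symmetry; apply: val_Wact.
by rewrite (whomE hu) -hind induced_Weyl.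
Qed.

End HomConstruction.
End SchurAction.

(** * Independence of semistandard words *)

Section Semistandard.
Variables (K : fieldType) (n r : nat) (a : seq nat).
Hypotheses (sum_a : sumn a = r) (sorted_a : sorted geq a).
Implicit Types (w : word n r) (T : Dbasis n r a) (k l : 'I_r).

Definition violation w k l : bool :=
  [&& blk a l == (blk a k).+1, off a l == off a k & (w l <= w k)%N].

(** Words of [Dbasis] already increase weakly along rows, so those satisfying [sst] are the
    semistandard tableaux. *)
Definition sst w : bool := [forall k, forall l, ~~ violation w k l].

Lemma off_lt_blk k l : off a k = off a l -> (k < l)%N -> (blk a k < blk a l)%N.
Proof.
move=> ho ltkl; have := reshape_leq a l k.
rewrite leqNgt ltkl /= => /esym/negbT; rewrite negb_or -leqNgt => /andP[+ _].
rewrite leq_eqVlt => /orP[/eqP hb|//].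
by have /eqP := box_inj hb ho; rewrite -val_eqE /= ltn_eqF.
Qed.

(** Induction on the row of the lower box; the intermediate boxes of the column exist because the
    row lengths decrease. *)
Lemma sst_strict w : sst w -> strictw (off a) w.
Proof.
move=> /forallP hw k l ho ltkl; move: (off_lt_blk ho ltkl).
move: {2}(blk a l) (leqnn (blk a l)) => N; move: l ho {ltkl}.
elim: N => [|N IH] l ho; first by rewrite leqn0 => /eqP ->.
move=> le_lN; case hl: (blk a l) => [|j] //; rewrite ltnS => le_kj.
have step k' : blk a k' = j -> off a k' = off a l -> (w k' < w l)%N.
  move=> hb' ho'; have /forallP/(_ l) := hw k'.
  by rewrite /violation hl hb' ho' !eqxx /= -ltnNge.
move: le_kj; rewrite leq_eqVlt => /orP[/eqP hk|lt_kj]; first exact: step.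
have [|k' [hb' ho']] := @box_exists r a sum_a j (off a l).
  apply: leq_trans (off_lt_nth sum_a l) _.
  by rewrite hl; apply: sorted_geq_nth.
apply: ltn_trans (step _ hb' ho'); apply: IH; rewrite ?hb' ?ho' //.
by rewrite hl in le_lN.
Qed.

(* The leading term of the image of T is the word T itself: a column
   rearrangement of T that is also a row rearrangement of some T' is at most
   as heavy as T', with equality only for T' itself. *)
Lemma dprime_sst_inj (x : Dspace K n r a) :
  (forall T, x T != 0 -> sst (val T)) -> dprime K n r a x = 0 -> x = 0.
Proof.
move=> x_sst; rewrite dprimeE => /eqP/mult_rearr_eq0P hx.
have {}hx := hx sum_a sorted_a.
apply/eqP; apply: contraT => x_n0.
have [T0 xT0] : exists T, x T != 0.
  apply/existsP; apply: contraR x_n0 => /existsPn h0; apply/eqP/ffunP=> T.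
  by rewrite ffunE; apply/eqP; have := h0 T; rewrite negbK.
pose wt w := (\sum_k off a k * w k)%N.
have [T xT maxT] := @arg_maxnP _ T0 (fun T => x T != 0) (fun T => wt (val T)) xT0.
have := hx (val T); rewrite /altsum (bigD1 1%g) ?keeps1 //= rp1.
rewrite odd_perm1 mul1r big1 => [|s /andP[hs ns1]].
  by rewrite addr0 -{1}(rp1 (val T)) comultE ?keeps1 // => /eqP; rewrite (negbTE xT).
have [t ht st] := sortedw_exists (blk a) (rp (val T) s).
have inc' : wincr a (rp (rp (val T) s) t) by apply/wincrP.
pose T' : Dbasis n r a := Sub _ inc'.
have eT' : rp (val T) s = rp (val T') t^-1%g by rewrite /= rpK.
rewrite eT' comultE ?keepsV //.
have [->|xT'] := eqVneq (x T') 0; first by rewrite mulr0.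
(* The factors [off] are constant on columns, so a column permutation does not change the weight. *)
have wt_s : wt (rp (val T) s) = wt (val T).
  rewrite /wt [RHS](reindex_inj (@perm_inj _ s)) /=; apply: eq_bigr => k _.
  by rewrite rpE; move/keepsP: hs => ->.
have eT'' : rp (val T') t^-1%g = val T'.
  apply: (@sortedw_heaviest r (blk a) n (off a)).
  - by move=> k l hb; rewrite off_ltn.
  - exact/wincrP/(valP T').
  - exact: keepsV.
  - by rewrite -eT' -/(wt _) -/(wt (rp _ s)) wt_s; apply: maxT.
have sT := sst_strict (x_sst _ xT); have sT' := sst_strict (x_sst _ xT').
case/eqP: ns1; apply: (strictw_fix sT hs).
by apply: (sortedw_uniq (strictwW sT) hs); rewrite eT' eT''; apply: strictwW.
Qed.

End Semistandard.

(** * Garnir elements and straightening *)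

Section JointOrbit.
Variables (r : nat) (T U : eqType).
Implicit Types (w : {ffun 'I_r -> T}) (c : {ffun 'I_r -> U}) (s : 'S_r).

(** Two pairs share an orbit exactly when each combination of letter and colour occurs equally often
    in both. *)
Definition jorb w0 c0 w c : bool := [exists s, (w == rp w0 s) && (c == rp c0 s)].

Lemma jorbP w0 c0 w c :
  reflect (exists s, w = rp w0 s /\ c = rp c0 s) (jorb w0 c0 w c).
Proof.
by apply: (iffP existsP) => [[s /andP[/eqP -> /eqP ->]]|[s [-> ->]]]; exists s;
  rewrite ?eqxx.
Qed.

Lemma jorb_rp w0 c0 w c s : jorb w0 c0 (rp w s) (rp c s) = jorb w0 c0 w c.
Proof.
apply/jorbP/jorbP => [[t [hw hc]]|[t [-> ->]]]; last first.
  by exists (s * t)%g; rewrite !rpM.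
exists (s^-1 * t)%g; rewrite -!rpM -hw -hc.
by split; symmetry; exact: rpK.
Qed.

End JointOrbit.

Section Garnir.
Variables (K : fieldType) (n r : nat) (a : seq nat).
Hypotheses (sum_a : sumn a = r) (sorted_a : sorted geq a).
Variable rowc : word n r.
Hypothesis rowcE : forall k, rowc k = blk a k :> nat.
Local Notation colouring := {ffun 'I_r -> option 'I_n}.
Implicit Types (w : word n r) (c : colouring) (k l : 'I_r).

(** The marking [c] arises from [w] by hiding some letters [i] and [i.+1]; [None] is a hidden
    letter. *)
Definition refines i w c : bool :=
  [forall k, if c k is Some j then j == w k
             else (w k == i :> nat) || (w k == i.+1 :> nat)].

Lemma refines_rp i w c s : refines i (rp w s) (rp c s) = refines i w c.
Proof.
apply/forallP/forallP => h k; last by rewrite !rpE; apply: h.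
by have := h (s^-1%g k); rewrite !rpE permKV.
Qed.

Lemma rowc_keeps s : keeps (blk a) s -> rp rowc s = rowc.
Proof.
move=> /keepsP hs; apply/ffunP=> k; rewrite rpE; apply: val_inj => /=.
by rewrite !rowcE hs.
Qed.

Section Violation.
Variables (T : word n r) (k l : 'I_r).
Hypothesis viol : violation a T k l.

(* None marks the letters that the Garnir element shuffles: in row blk a k those
   at least T k, in the next row those at most T l. *)
Definition garnir_col : colouring :=
  [ffun b => if (blk a b == blk a k) && (T k <= T b)%N
                || (blk a b == (blk a k).+1) && (T b <= T l)%N
             then None else Some (rowc b)].

(** As a row-invariant tensor: the fixed letters of each row, multiplied in DV by the comultiplied
    monomial of the shuffled letters. Multiplication of such tensors is the shuffle product, so the
    coefficient at [w] counts markings of its slots. *)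
Definition garnir : tpow K n r :=
  [ffun w => \sum_(c | refines (blk a k) rowc c) (jorb T garnir_col w c)%:R].

Lemma garnir_yinv : yinv a garnir.
Proof.
move=> w s hs; rewrite !ffunE (reindex_inj (@rp_inj _ _ s)) /=.
apply: eq_big => [c|c _]; last by rewrite jorb_rp.
by rewrite -{1}(rowc_keeps hs) refines_rp.
Qed.

Lemma garnir_col_None b : garnir_col b = None ->
  (blk a b == blk a k) && (T k <= T b)%N ||
  (blk a b == (blk a k).+1) && (T b <= T l)%N.
Proof. by rewrite ffunE; case: ifP. Qed.

Lemma garnir_col_Some b j : garnir_col b = Some j -> j = rowc b.
Proof. by rewrite ffunE; case: ifP => // _ []. Qed.

Lemma refines_garnir_col : refines (blk a k) rowc garnir_col.
Proof.
apply/forallP => b; case e: (garnir_col b) => [j|].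
  by rewrite (garnir_col_Some e).
by rewrite !rowcE; case/orP: (garnir_col_None e) => /andP[-> _]; rewrite ?orbT.
Qed.

Definition stat w : nat := \sum_b blk a b * w b.

Lemma garnir_triangular w c : sortedw (blk a) T -> sortedw (blk a) w ->
  refines (blk a k) rowc c -> jorb T garnir_col w c ->
  (w = T /\ c = garnir_col) \/ (stat T < stat w)%N.
Proof.
move=> sT sw /forallP hc; set i := blk a k in hc *.
have le_lk : (T l <= T k)%N by case/and3P: viol.
pose cond s := (w == rp T s) && (c == rp garnir_col s).
pose P (s : 'S_r) := [set b : 'I_r | blk a b == i] :\: [set b | blk a (s b) == i].
case/existsP => s0 hs0.
(* Choose s moving as few boxes as possible between the two rows. *)
have [s /andP[/eqP ew /eqP ec] smin] := @arg_minnP _ s0 cond (fun s => #|P s|) hs0.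
pose Q := [set b : 'I_r | blk a (s b) == i] :\: [set b | blk a b == i].
have wE b : w b = T (s b) by rewrite ew rpE.
have cE b : c b = garnir_col (s b) by rewrite ec rpE.
have same b j : c b = Some j -> blk a (s b) = blk a b.
  move=> e; have := hc b; rewrite e -!rowcE => /eqP <-.
  by rewrite cE in e; rewrite (garnir_col_Some e).
have cNone b : c b = None ->
    ((blk a (s b) == i) && (T k <= w b)%N || (blk a (s b) == i.+1) && (w b <= T l)%N) &&
    ((blk a b == i) || (blk a b == i.+1)).
  by move=> e; have := hc b; rewrite e !rowcE => ->;
    rewrite andbT wE garnir_col_None // -cE.
have PP b : b \in P s -> [/\ c b = None, blk a b = i, blk a (s b) = i.+1 & (w b <=
  T l)%N].
  rewrite !inE => /andP[h1 /eqP h2]; case e: (c b) => [j|].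
    by move: h1; rewrite (same _ _ e) h2 eqxx.
  by case/andP: (cNone b e); rewrite (negbTE h1) /= => /andP[/eqP -> ->].
have QP b : b \in Q -> [/\ c b = None, blk a b = i.+1, blk a (s b) = i & (T k <= w
  b)%N].
  rewrite !inE => /andP[h1 /eqP h2]; case e: (c b) => [j|].
    by move: h1; rewrite -(same _ _ e) h2 eqxx.
  case/andP: (cNone b e); rewrite (negbTE h1) h2 eqxx /= => h /eqP ->.
  by case/orP: h => [->|/andP[]] //; rewrite eqn_leq ltnn andbF.
(* Row [i] has a fixed length, so as many letters leave it as enter it. *)
have cardPQ : #|P s| = #|Q|.
  apply/eqP; rewrite -(eqn_add2l #|[set b | blk a b == i] :&: [set b : 'I_r | blk a
    (s b) == i]|).
  rewrite cardsID setIC cardsID; apply/eqP.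
  rewrite -(card_preimset _ (@perm_inj _ s)).
  by apply: eq_card => b; rewrite !inE.
(* Without crossings [s] is a row permutation, and sortedness forces [w = T]. *)
have [P0|[b0 b0P]] := set_0Vmem (P s).
  have Q0 : Q = set0 by apply/eqP; rewrite -cards_eq0 -cardPQ P0 cards0.
  left; have ks : keeps (blk a) s.
    apply/keepsP => b; case e: (c b) => [j|]; first exact: same e.
    have := in_set0 b; rewrite -{1}P0 !inE; have := in_set0 b; rewrite -{1}Q0 !inE.
    case/andP: (cNone b e).
    by do 2!case: (blk a b =P i); do 2!case: (blk a (s b) =P i) => //=; move=> *; lia.
  have hks := elimT (keepsP _ _) ks.
  have ewT : w = T by rewrite ew (sortedw_uniq sT ks) // -ew.
  split=> //; apply/ffunP=> b; rewrite cE !ffunE hks.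
  rewrite -wE ewT; case: ifP => // _; congr Some; apply: val_inj.
  by rewrite /= !rowcE hks.
right.
have Ngt0 : (0 < #|P s|)%N by apply/card_gt0P; exists b0.
(* Two equal letters could stay in their rows after composing [s] with a transposition, against
   minimality. *)
have strict b b' : b \in P s -> b' \in Q -> (w b < w b')%N.
  move=> bP bQ; have [cb hb hsb le_b] := PP b bP; have [cb' hb' hsb' le_b'] := QP b' bQ.
  rewrite ltn_neqAle (leq_trans (leq_trans le_b le_lk) le_b') andbT.
  apply/negP => /eqP/val_inj eqw.
  have : cond (tperm b b' * s)%g.
    by rewrite /cond -!rpM -ew -ec !rp_tperm ?eqxx // cb cb'.
  move/smin; rewrite leqNgt => /negP; apply; apply: proper_card.
  apply/properP; split; last first.
    by exists b => //; rewrite !inE permM tpermL hsb' eqxx.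
  apply/subsetP=> x; rewrite !inE permM.
  case: tpermP => [->|->|] //; first by rewrite hsb' eqxx.
  by rewrite hb' (gtn_eqF (ltnSn _)) andbF.
(* Sum [strict] over all pairs and cancel the common size of the two sets. *)
have sumPQ : (\sum_(b in P s) w b + #|P s| <= \sum_(b in Q) w b)%N.
  rewrite -(leq_pmul2l Ngt0) {2}cardPQ mulnDr.
  have -> : (#|P s| * \sum_(b in P s) w b + #|P s| * #|Q| =
      \sum_(b in P s) \sum_(b' in Q) (w b).+1)%N.
    under [RHS]eq_bigr do rewrite sum_nat_const -addn1.
    by rewrite -big_distrr big_split /= sum1_card -cardPQ mulnDr.
  have -> : (#|P s| * \sum_(b in Q) w b = \sum_(b in P s) \sum_(b' in Q) w b')%N.
    by rewrite sum_nat_const.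
  by apply: leq_sum => b bP; apply: leq_sum => b' bQ; apply: strict.
(* [stat] gains the letters at [Q], which came one row down, and loses those at [P], which came one
   row up. *)
have statE : (stat w + \sum_(b in P s) w b = stat T + \sum_(b in Q) w b)%N.
  rewrite /stat [X in (_ = X + _)%N](reindex_inj (@perm_inj _ s)) /=.
  rewrite (big_mkcond (fun b => b \in P s)) (big_mkcond (fun b => b \in Q)).
  rewrite -!big_split /=; apply: eq_bigr => b _; rewrite -wE.
  have [bP|nP] := boolP (b \in P s); have [bQ|nQ] := boolP (b \in Q).
  - by move: bQ; case/PP: bP => _ hb _ _; rewrite !inE hb eqxx.
  - by case/PP: bP => _ -> -> _; lia.
  - by case/QP: bQ => _ -> -> _; lia.
  suff -> : blk a (s b) = blk a b by [].
  case e: (c b) => [j|]; first exact: same e.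
  move: nP nQ; rewrite !inE; case/andP: (cNone b e).
  by do 2!case: eqP => //=; move=> *; lia.
lia.
Qed.

Lemma garnir_self : sortedw (blk a) T -> garnir T = 1.
Proof.
move=> sT; rewrite ffunE (bigD1 garnir_col) ?refines_garnir_col //=.
rewrite (_ : jorb _ _ _ _) /=; last by apply/jorbP; exists 1%g; rewrite !rp1.
rewrite big1 ?addr0 // => c /andP[rc nc]; case: (boolP (jorb _ _ _ _)) => // jc.
have [[_ /eqP]|] := garnir_triangular sT sT rc jc; first by rewrite (negbTE nc).
by rewrite ltnn.
Qed.

Lemma garnir_stat w : sortedw (blk a) T -> sortedw (blk a) w ->
  garnir w != 0 -> w = T \/ (stat T < stat w)%N.
Proof.
move=> sT sw; rewrite ffunE => nz.
have [c rc jc] : exists2 c, refines (blk a k) rowc c & jorb T garnir_col w c.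
  have [c /andP[rc jc]|none] := pickP (fun c =>
    refines (blk a k) rowc c && jorb T garnir_col w c).
    by exists c.
  case/eqP: nz; apply: big1 => c rc.
  by have := none c; rewrite rc /= => ->.
by have [[-> _]|] := garnir_triangular sT sw rc jc; [left|right].
Qed.

(** The shuffled boxes include row [blk a k] from the column of [k] on and the next row up to that
    column, one box more than the length of the row. *)
Lemma card_garnir_None : sortedw (blk a) T ->
  (nth 0 a (blk a k) < #|[set b | garnir_col b == None]|)%N.
Proof.
move=> sT; case/and3P: viol => /eqP hb /eqP ho _; set i := blk a k in hb *.
have lt_k : (off a k < nth 0 a i)%N by apply: off_lt_nth.
have lt_l : (off a k < nth 0 a i.+1)%N by rewrite -ho -hb; apply: off_lt_nth.
have mono (b b' : 'I_r) : blk a b = blk a b' -> (off a b <= off a b')%N -> (T b <=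
  T b')%N.
  move=> hbb; rewrite leq_eqVlt => /orP[/eqP/(box_inj hbb) -> //|].
  by rewrite off_ltn // => lt; apply: sT.
(* Indices up to [off a k] run through the lower row. The others are shifted by one, since the
   column of [k] occurs in both rows. *)
have ex (o : 'I_(nth 0%N a i).+1) : exists b : 'I_r, [/\ garnir_col b = None,
    blk a b = (if (o <= off a k)%N then i.+1 else i) &
    off a b = (if (o <= off a k)%N then val o else o.-1)].
  case: leqP => hk.
    have [b [hb1 hb2]] := box_exists sum_a (leq_ltn_trans hk lt_l).
    have le_b : (T b <= T l)%N by rewrite mono ?hb ?hb1 ?hb2 ?ho.
    by exists b; split=> //; rewrite ffunE hb1 -/i eqxx le_b orbT.
  have [|b [hb1 hb2]] := @box_exists r a sum_a i o.-1.
    by have := ltn_ord o; lia.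
  have le_b : (T k <= T b)%N by rewrite mono ?hb1 ?hb2 //; lia.
  by exists b; split=> //; rewrite ffunE hb1 eqxx le_b.
have [f hf] := fin_all_exists ex.
have f_inj : injective f.
  move=> o o' e; have [_ h1 h2] := hf o; have [_ h1' h2'] := hf o'.
  rewrite -e h1 in h1'; rewrite -e h2 in h2'; apply: val_inj => /=.
  by move: h1' h2'; case: leqP => h3; case: leqP => h4 /=; lia.
rewrite -[X in (X <= _)%N]card_ord -cardsT -(card_imset _ f_inj).
apply/subset_leq_card/subsetP=> _ /imsetP[o _ ->].
by rewrite inE; have [-> _ _] := hf o.
Qed.

Lemma card_jorb_None w c : jorb T garnir_col w c ->
  #|[set b | c b == None]| = #|[set b | garnir_col b == None]|.
Proof.
case/jorbP => s [_ ->]; rewrite -[RHS](card_preimset _ (@perm_inj _ s)).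
by apply: eq_card => b; rewrite !inE rpE.
Qed.

(** By pigeonhole two [None] slots of each marking share a column. Exchanging them preserves the
    marking, so its contribution is symmetric in these slots and its signed sum vanishes. *)
Lemma garnir_altsum : sortedw (blk a) T -> forall w, altsum (off a) garnir w = 0.
Proof.
move=> sT w; pose J c : tpow K n r := [ffun w => (jorb T garnir_col w c)%:R].
have -> : altsum (off a) garnir w =
    \sum_(c | refines (blk a k) rowc c) altsum (off a) (J c) w.
  rewrite exchange_big; apply: eq_bigr => s _; rewrite ffunE mulr_sumr.
  by apply: eq_bigr => c _; rewrite ffunE.
apply: big1 => c /forallP rc; set i := blk a k in rc.
have [no_orb|[w0 w0c]] : (forall u, ~~ jorb T garnir_col u c) \/ exists u, jorb T
  garnir_col u c.
- have [/existsP|/existsPn] := boolP [exists u, jorb T garnir_col u c];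
  [by right|by left].
- by rewrite /altsum big1 // => s _; rewrite ffunE (negbTE (no_orb _)) mulr0.
have := card_garnir_None sT; rewrite -(card_jorb_None w0c) -/i => ltZ.
set Z := [set b | c b == None] in ltZ.
have rowZ b : b \in Z -> (blk a b == i) || (blk a b == i.+1).
  by rewrite inE => /eqP e; have := rc b; rewrite e !rowcE.
have [b [b' [bZ b'Z nbb ebb]]] : exists b b', [/\ b \in Z, b' \in Z, b != b' & off
  a b = off a b'].
  pose bad := [pred bb : 'I_r * 'I_r | [&& bb.1 \in Z, bb.2 \in Z, bb.1 != bb.2 &
    off a bb.1 == off a bb.2]].
  have [[b b'] /and4P[/= h1 h2 h3 /eqP h4]|none] := pickP bad; first by exists b, b'.
  suff : (#|Z| <= nth 0 a i)%N by rewrite leqNgt ltZ.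
  rewrite cardE -(size_map (off a)) -(size_iota 0 (nth 0%N a i)); apply: uniq_leq_size.
    rewrite map_inj_in_uniq ?enum_uniq // => b b'; rewrite !mem_enum => bZ b'Z ebb.
    apply/eqP; apply: contraT => nbb; have := none (b, b').
    by rewrite /= bZ b'Z nbb ebb eqxx.
  move=> _ /mapP[b + ->]; rewrite mem_enum => /rowZ rb; rewrite mem_iota /= add0n.
  apply: leq_trans (off_lt_nth sum_a b) _; apply: sorted_geq_nth => //.
  by case/orP: rb => /eqP ->.
apply: (altsum_sym_eq0 nbb ebb) => u; rewrite !ffunE.
move: bZ b'Z; rewrite !inE => /eqP cb /eqP cb'.
by rewrite -{1}(rp_tperm (c := c) (k := b) (l := b')) ?jorb_rp // cb cb'.
Qed.

End Violation.

Lemma stat_bound w : (stat w <= \sum_(b < r) blk a b * n)%N.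
Proof. by apply: leq_sum => b _; rewrite leq_mul2l ltnW ?orbT. Qed.

Lemma restrD_garnir_dprime (T : Dbasis n r a) k l : violation a (val T) k l ->
  dprime K n r a (restrD a (garnir (val T) k l)) = 0.
Proof.
move=> hv; rewrite dprimeE restrDK; last exact: garnir_yinv.
apply/eqP/mult_rearr_eq0P => //; apply: garnir_altsum => //.
exact/wincrP/(valP T).
Qed.

(** * Straightening modulo Garnir elements *)

Section Kernel.
Variables (W : vectType K) (Phi : 'Hom(Dspace K n r a, W)).
Hypothesis Phi_garnir : forall (T : Dbasis n r a) k l, violation a (val T) k l ->
  Phi (restrD a (garnir (val T) k l)) = 0.

Definition correction (T : Dbasis n r a) : Dspace K n r a :=
  if [pick kl | violation a (val T) kl.1 kl.2] is Some kl
  then restrD a (garnir (val T) kl.1 kl.2) else 0.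

(** Subtracting Garnir elements removes the words that are not semistandard at the cost of words
    with larger [stat]; this ends because [stat] is bounded. *)
Lemma straighten (x : Dspace K n r a) : exists y : Dspace K n r a,
  [/\ forall T, y T != 0 -> sst a (val T), dprime K n r a y = dprime K n r a x
    & Phi y = Phi x].
Proof.
pose M := (\sum_(b < r) blk a b * n)%N.
(* [N] measures how far [stat] can be below its bound [M] on the words still to be removed; for
   [N = 0] none is left. *)
suff main N : forall x : Dspace K n r a,
    (forall T, x T != 0 -> ~~ sst a (val T) -> (M < stat (val T) + N)%N) ->
    exists y : Dspace K n r a, [/\ forall T, y T != 0 -> sst a (val T),
      dprime K n r a y = dprime K n r a x & Phi y = Phi x].
  by apply: (main M.+1) => T _ _; rewrite addnS ltnS leq_addl.
elim: N {x} => [|N IH] x hx.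
  exists x; split=> // T xT; apply: contraT => nT.
  by have := hx T xT nT; rewrite addn0 ltnNge stat_bound.
have sT (T : Dbasis n r a) : sortedw (blk a) (val T) by apply/wincrP/(valP T).
have corrE (T : Dbasis n r a) : ~~ sst a (val T) -> exists k l,
    violation a (val T) k l /\ correction T = restrD a (garnir (val T) k l).
  case/forallPn => k /forallPn[l]; rewrite negbK => hv; rewrite /correction.
  case: pickP => [[k' l'] hv'|/(_ (k, l))]; last by rewrite hv.
  by exists k', l'.
pose z := \sum_(T | ~~ sst a (val T)) x T *: correction T.
have zE T' : z T' = \sum_(T | ~~ sst a (val T)) x T * correction T T'.
  by rewrite sum_ffunE; apply: eq_bigr => T _; rewrite ffunE.
have killed (V : vectType K) (F : 'Hom(Dspace K n r a, V)) :
    (forall (T : Dbasis n r a) k l, violation a (val T) k l ->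
       F (restrD a (garnir (val T) k l)) = 0) -> F (x - z) = F x.
  move=> F0; rewrite linearB linear_sum big1 ?subr0 // => T nT.
  by have [k [l [hv ->]]] := corrE T nT; rewrite linearZ /= F0 ?scaler0.
have [T' xT' nT'|y [y_sst y_d y_Phi]] := IH (x - z); last first.
  exists y; split=> //; last by rewrite y_Phi killed.
  by rewrite y_d killed // => *; apply: restrD_garnir_dprime.
have [k' [l' [hv' corr']]] := corrE T' nT'.
(* By [garnir_self] the correction of [T'] cancels its own coefficient, so what survives comes from
   another [T], of smaller [stat]. *)
have : \sum_(T | ~~ sst a (val T) && (T != T')) x T * correction T T' != 0.
  move: xT'; rewrite !ffunE zE (bigD1 T') //= corr' ffunE (garnir_self hv') //.
  by rewrite mulr1 opprD addNKr oppr_eq0.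
move/eqP=> nz; have [T /andP[/andP[nT neT] nzT]|none] :=
  pickP (fun T => ~~ sst a (val T) && (T != T') && (x T * correction T T' != 0));
    last first.
  case: nz; apply: big1 => T hT; have := none T.
  by rewrite hT /= => /negbT; rewrite negbK => /eqP.
have [k [l [hv corr]]] := corrE T nT.
move: nzT; rewrite mulf_eq0 negb_or corr ffunE => /andP[xT gT].
have [/val_inj e|lt_stat] := garnir_stat hv (sT T) (sT T') gT.
  by rewrite e eqxx in neT.
have := hx T xT nT; rewrite addnS ltnS => /leq_ltn_trans; apply.
by rewrite ltn_add2r.
Qed.

(** Straightening replaces [x] by a semistandard combination in the kernel of [dprime], which is 0
    by [dprime_sst_inj]. *)
Lemma ker_dprime (x : Dspace K n r a) : dprime K n r a x = 0 -> Phi x = 0.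
Proof.
move=> dx; have [y [y_sst dy <-]] := straighten x.
by rewrite (dprime_sst_inj sum_a sorted_a y_sst) ?linear0 // dy.
Qed.

End Kernel.
End Garnir.

(** * Binomial sums *)

Lemma dvdn_RgcdP (p x y : nat) :
  reflect (forall k, (0 < k <= y)%N -> (p %| 'C(x + k, k))%N) (p %| Rgcd (x + 1) y)%N.
Proof.
apply: (iffP (dvdn_biggcdP _ _ _)) => h => [[|k] //= ky|k _].
  by have := h (Ordinal ky) isT; rewrite /= -addnA add1n.
by rewrite -addnA add1n; apply: h; rewrite /= ltn_ord.
Qed.

(** The Vandermonde expansion of C(x+1+e, q) with e < q has zero term at j = 0. Induction on j then
    gives p | C(x+1, j) for 0 < j <= y, and expanding C(N, q) once more gives the claim. *)
Lemma dvdn_bin_shift (p x y : nat) :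
  (forall k, (0 < k <= y)%N -> (p %| 'C(x + k, k))%N) ->
  forall N q, (q <= y)%N -> (x < N)%N -> (N <= x + q)%N -> (p %| 'C(N, q))%N.
Proof.
move=> hp; have step e q : (e < q)%N -> (p %| \sum_(1 <= j < q) 'C(x.+1, j) * 'C(e,
  q - j))%N ->
    (p %| 'C(x.+1 + e, q))%N = (p %| 'C(x.+1, q))%N.
  move=> eq hs; rewrite -binomial.Vandermonde -(big_mkord predT (fun j =>
    'C(x.+1, j) * 'C(e, q - j))%N).
  rewrite big_nat_recr //= big_ltn ?(leq_trans _ eq) // subn0 (bin_small eq) muln0
    add0n subnn bin0 muln1.
  by rewrite dvdn_addr.
have dvd_j j : (0 < j <= y)%N -> (p %| 'C(x.+1, j))%N.
  elim/ltn_ind: j => -[|j] IH // /andP[_ jy].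
  rewrite -(step j) //; first by rewrite addSnnS hp.
  rewrite big_nat; apply: dvdn_sum => i /andP[i0 ij].
  by rewrite dvdn_mulr // IH // i0 (leq_trans (ltnW ij)).
move=> N q qy xN Nq; rewrite -(subnKC xN) step; last 2 first.
- by lia.
- rewrite big_nat; apply: dvdn_sum => i /andP[i0 iq].
  by rewrite dvdn_mulr // dvd_j // i0 (leq_trans (ltnW iq)).
by rewrite dvd_j // qy andbT; lia.
Qed.

(** * Binomial sums over subsets *)

Section SubsetSums.
Variables (I : finType) (M : nmodType).
Implicit Types A B D L U : {set I}.

Lemma sum_interval L U (F : {set I} -> M) : L \subset U ->
  \sum_(B : {set I} | (L \subset B) && (B \subset U)) F B =
  \sum_(D : {set I} | D \subset U :\: L) F (L :|: D).
Proof.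
move=> LU; rewrite (reindex_onto (setU L) (fun B => B :\: L)) /= => [|B /andP[LB _]].
  apply: eq_bigl => D; rewrite subsetUl subUset LU subsetD.
  case: (D \subset U) => //=; rewrite setDUl setDv set0U.
  by apply/eqP/setDidPl.
by rewrite setDE setUIr setUCr setIT; apply/setUidPr.
Qed.

Lemma sum_subsetsD1 U e (F : {set I} -> M) : e \in U ->
  \sum_(D : {set I} | D \subset U) F D = \sum_(D : {set I} | D \subset U :\ e) (F
    (e |: D) + F D).
Proof.
move=> eU; rewrite (bigID (fun D : {set I} => e \in D)) big_split /=; congr (_ + _).
  rewrite (reindex_onto (setU [set e]) (fun D => D :\ e)) /= => [|D /andP[_ eD]];
    last exact: setD1K.
  apply: eq_bigl => D; rewrite setU11 andbT subUset sub1set eU subsetD1 /=.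
  case: (D \subset U) => //=; apply/eqP/idP => [<-|eD]; first by rewrite setD11.
  by rewrite setU1K.
by apply: eq_bigl => D; rewrite subsetD1.
Qed.

End SubsetSums.

(** Vandermonde with subsets in place of their sizes; removing one element of [U] is one use of
    Pascal's rule. *)
Lemma sum_bin_subsets (I : finType) (U : {set I}) y c :
  (\sum_(D : {set I} | D \subset U) 'C(y, c + #|D|) = 'C(y + #|U|, c + #|U|))%N.
Proof.
move: {2}#|U| (erefl #|U|) => N; elim: N U y c => [|N IH] U y c.
  move/eqP; rewrite cards_eq0 => /eqP ->.
  under eq_bigl do rewrite subset0.
  by rewrite big_pred1_eq cards0 !addn0.
move=> hU; have [e eU] : exists e, e \in U by apply/card_gt0P; rewrite hU.
have hU' : #|U :\ e| = N by move: hU; rewrite (cardsD1 e) eU => -[].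
rewrite (sum_subsetsD1 _ eU) hU.
rewrite (eq_bigr (fun D : {set I} => 'C(y.+1, c.+1 + #|D|))%N) => [|D].
  by rewrite IH // hU' !addSnnS.
by rewrite subsetD1 => /andP[_ eD]; rewrite cardsU1 eD addnCA add1n addSn binS.
Qed.

(** An iterated difference over the elements of [U]: one outside [S] gives 0, one inside [S] lowers
    [A] by Pascal's rule. This is the inclusion-exclusion for the first two rows. *)
Lemma sum_signed_bin_subsets (R : pzRingType) (I : finType) (U S : {set I}) m A :
  (#|U| <= A)%N ->
  \sum_(D : {set I} | D \subset U) (-1) ^+ #|U :\: D| * 'C(m + #|D :&: S|, A)%:R =
  (if U \subset S then 'C(m, A - #|U|)%:R else 0) :> R.
Proof.
move: {2}#|U| (erefl #|U|) => N; elim: N U A => [|N IH] U A.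
  move/eqP; rewrite cards_eq0 => /eqP -> _.
  under eq_bigl do rewrite subset0.
  by rewrite big_pred1_eq sub0set set0D set0I cards0 mul1r addn0 subn0.
move=> hU; have [e eU] : exists e, e \in U by apply/card_gt0P; rewrite hU.
have hU' : #|U :\ e| = N by move: hU; rewrite (cardsD1 e) eU => -[].
case: A => [|A]; first by rewrite hU.
rewrite hU ltnS => leNA; rewrite (sum_subsetsD1 _ eU).
have sgnE (D : {set I}) : D \subset U :\ e ->
    #|U :\: (e |: D)| = #|(U :\ e) :\: D| /\ #|U :\: D| = #|(U :\ e) :\: D|.+1.
  rewrite subsetD1 => /andP[_ eD]; split; first by rewrite setDDl.
  by rewrite (cardsD1 e) !inE eD eU setDDl setUC -setDDl.
have US : (U \subset S) = (e \in S) && (U :\ e \subset S).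
  by rewrite -{1}(setD1K eU) subUset sub1set.
rewrite US; case: (boolP (e \in S)) => eS /=; last first.
  apply: big1 => D DU; have [-> ->] := sgnE D DU.
  rewrite exprS mulN1r mulNr (_ : (e |: D) :&: S = D :&: S) ?subrr //.
  by apply/setP=> x; rewrite !inE; have [->|//] := eqVneq x e;
    rewrite (negbTE eS) !andbF.
rewrite -hU' subSS -IH ?hU' //; apply: eq_bigr => D DU; have [-> ->] := sgnE D DU.
have eD : e \notin D by move: DU; rewrite subsetD1 => /andP[].
rewrite exprS mulN1r mulNr -mulrBr; congr (_ * _).
have -> : (e |: D) :&: S = e |: (D :&: S).
  by apply/setP=> x; rewrite !inE; have [->|//] := eqVneq x e; rewrite eS.
by rewrite cardsU1 inE (negbTE eD) /= add1n addnS binS natrD addrAC subrr add0r.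
Qed.

(** * Maps given by families of colourings *)

Section Counting.
Variables (r : nat) (T : finType).
Implicit Types c d : {ffun 'I_r -> T}.

Lemma card_rp c s (P : pred T) : #|[set x | P (rp c s x)]| = #|[set x | P (c x)]|.
Proof.
rewrite -[RHS](card_preimset _ (@perm_inj _ s)).
by apply: eq_card => x; rewrite !inE rpE.
Qed.

Lemma rp_of_counts c d :
  (forall j, #|[set x | c x == j]| = #|[set x | d x == j]|) -> exists s, c = rp d s.
Proof.
move=> h; pose tup (g : {ffun 'I_r -> T}) := [tuple g x | x < r].
have cnt (g : {ffun 'I_r -> T}) j : count_mem j (tup g) = #|[set x | g x == j]|.
  by rewrite /= count_map cardsE cardE enumT size_filter.
have /tuple_permP[s hs] : perm_eq (tup c) (tup d).
  by apply/allP=> j _ /=; rewrite !cnt h.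
exists s; apply/ffunP=> x; rewrite rpE.
have /val_inj/(congr1 (fun t => tnth t x)) := hs.
by rewrite !tnth_mktuple.
Qed.

End Counting.

Section Theta.
Variables (K : fieldType) (n r : nat) (a b : seq nat).
Hypotheses (sum_a : sumn a = r) (sorted_a : sorted geq a).
Hypotheses (sum_b : sumn b = r) (sorted_b : sorted geq b).
Hypothesis b_two : nth 0%N b 2 = 0%N.
Variable rowc : word n r.
Hypothesis rowcE : forall k, rowc k = blk a k :> nat.
Local Notation colouring := {ffun 'I_r -> option 'I_n}.
Implicit Types (w e : word n r) (c : colouring) (k l : 'I_r) (f : tpow K n r).

Definition top : {set 'I_r} := [set k | blk b k == 0%N].

(** The values [t = n] and [t = 2] give the two families of colourings. *)
Definition allowed (t j : nat) (k : 'I_r) : bool :=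
  ((j == 0%N) ==> (k \in top)) && ((t <= j)%N ==> (k \notin top)).

Definition admissible t e : bool :=
  [exists s, e == rp rowc s] && [forall k, allowed t (e k) k].

(** Any two choices for an admissible [e] differ by a row permutation of [a], so row-invariant
    tensors do not see the choice ([yinv_straightening]). *)
Definition straightening_perm e : 'S_r := odflt 1%g [pick s | e == rp rowc s].

Definition theta t : 'End(tpow K n r) :=
  \sum_(e | admissible t e) place K n (straightening_perm e).

Lemma thetaE t f w :
  theta t f w = \sum_(e | admissible t e) f (rp w (straightening_perm e)^-1%g).
Proof.
by rewrite sum_lfunE sum_ffunE; apply: eq_bigr => e _; rewrite placeE.
Qed.

Lemma theta_schur t x f : x \in schur K n r -> theta t (x f) = x (theta t f).
Proof.
move=> xS; rewrite !sum_lfunE linear_sum; apply: eq_bigr => e _.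
exact/esym/schur_place.
Qed.

Lemma yinv_straightening f w e s : yinv a f -> e = rp rowc s ->
  f (rp w (straightening_perm e)^-1%g) = f (rp w s^-1%g).
Proof.
move=> hf he; rewrite /straightening_perm; case: pickP => [g /eqP hg|/(_ s)];
  last first.
  by rewrite he eqxx.
have -> : rp w s^-1%g = rp (rp w g^-1%g) (s^-1 * g)%g.
  by rewrite rpM -mulgA mulgV mulg1.
rewrite [RHS]hf //; apply/keepsP=> k; rewrite -!rowcE -!(rpE rowc).
by rewrite -rpM -hg he rpK.
Qed.

Lemma admissible_rp t e s : keeps (blk b) s -> admissible t (rp e s) = admissible t e.
Proof.
move=> ks; congr (_ && _).
  apply/existsP/existsP => [[g /eqP h]|[g /eqP ->]].
    by exists (s^-1 * g)%g; rewrite -rpM -h rpK.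
  by exists (s * g)%g; rewrite rpM.
have topE k : (s k \in top) = (k \in top) by rewrite !inE (keepsP _ _ ks).
apply/forallP/forallP => h k; last by have := h (s k); rewrite rpE /allowed topE.
by have := h (s^-1%g k); rewrite rpE permKV /allowed -{1 2}topE permKV.
Qed.

Lemma theta_yinv t f : yinv a f -> yinv b (theta t f).
Proof.
move=> hf w s ks; rewrite !thetaE (reindex_inj (@rp_inj _ _ s)) /=.
apply: eq_big => [e|e]; first exact: admissible_rp.
case/andP=> /existsP[g' /eqP eg'] _.
have [g eg] : exists g, e = rp rowc g.
  by exists (s^-1 * g')%g; rewrite -rpM -eg' rpK.
rewrite (yinv_straightening _ hf eg) (yinv_straightening (s := (s * g)%g) _ hf).
  by rewrite rpM invMg -mulgA mulVg mulg1.
by rewrite eg rpM.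
Qed.

(** * Values of the maps on a Garnir element *)

Section OnGarnir.
Variables (T : word n r) (k l : 'I_r).
Hypotheses (viol : violation a T k l) (sT : sortedw (blk a) T).
Local Notation i := (blk a k).
Local Notation c0 := (garnir_col a rowc T k l).

Definition nones c : {set 'I_r} := [set x | c x == None].

Definition fill c (X : {set 'I_r}) : word n r :=
  [ffun x => if c x is Some j then j else if x \in X then rowc k else rowc l].

(** The number of hidden slots that a completion must assign to the upper row to have the content of
    [rowc]; see [fill_orbit]. *)
Definition pulled : nat := #|[set x in nones c0 | blk a x == i]|.

(** Exchanging the sums over colourings and markings collects, for each marking, the number of its
    admissible completions. Divisibility of these numbers by p is then enough. *)
Lemma theta_garnir t w : theta t (garnir K a rowc T k l) w =
  \sum_c (jorb T c0 w c)%:R *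
     #|[set e | admissible t e && refines i e c]|%:R.
Proof.
rewrite thetaE.
rewrite (eq_bigr (fun e => \sum_(c | refines i e c) (jorb T c0 w c)%:R)) => [|e].
  rewrite (exchange_big_dep predT) //=; apply: eq_bigr => c _.
  by rewrite sumr_const [RHS]mulr_natr; congr (_ *+ _); apply: eq_card => e;
    rewrite !inE.
case/andP=> /existsP[g /eqP eg] _.
rewrite (yinv_straightening _ (garnir_yinv K rowcE T k l) eg) ffunE.
rewrite (reindex_inj (@rp_inj _ _ g^-1%g)) /=; apply: eq_big => [c|c _].
  by rewrite -(refines_rp _ _ _ g) rpVK -eg.
by rewrite jorb_rp.
Qed.

Let blk_l : blk a l = i.+1.
Proof. by case/and3P: viol => /eqP. Qed.

Let rowc_kl : rowc k != rowc l.
Proof. by rewrite -val_eqE /= !rowcE blk_l ltn_eqF. Qed.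

Lemma refines_fill c X : refines i (fill c X) c.
Proof.
apply/forallP=> x; rewrite !ffunE; case: (c x) => [j|] //.
by case: ifP => _; rewrite rowcE ?blk_l eqxx ?orbT.
Qed.

Lemma refinesP e c : refines i e c ->
  e = fill c [set x in nones c | e x == rowc k].
Proof.
move=> /forallP he; apply/ffunP=> x; rewrite ffunE; have := he x.
case hc: (c x) => [j|]; first by move/eqP.
rewrite !inE hc eqxx /= -blk_l -!rowcE !val_eqE.
by case: eqP => //= _ /eqP.
Qed.

Lemma fill_inj c (X Y : {set 'I_r}) : X \subset nones c -> Y \subset nones c ->
  fill c X = fill c Y -> X = Y.
Proof.
move=> /subsetP hX /subsetP hY /ffunP h; apply/setP=> x.
have [xn|xn] := boolP (x \in nones c); last first.
  by rewrite (contraNF (hX x) xn) (contraNF (hY x) xn).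
have := h x; rewrite !ffunE; move: xn; rewrite inE => /eqP ->.
have nkl := negbTE rowc_kl.
by case: (x \in X); case: (x \in Y) => // /eqP; rewrite ?nkl // eq_sym nkl.
Qed.

Lemma card_fill c (X : {set 'I_r}) j : X \subset nones c ->
  #|[set x | fill c X x == j]| = (#|[set x | c x == Some j]| +
    (if j == rowc k then #|X| else if j == rowc l then #|nones c :\: X| else 0))%N.
Proof.
move=> XN; rewrite -[LHS](cardsID (nones c)) [LHS]addnC; congr addn.
  apply: eq_card => x; rewrite !inE ffunE.
  by case: (c x) => [j'|] //=; rewrite (inj_eq Some_inj).
have nkl := negbTE rowc_kl; case: eqVneq => [->|njk].
  apply: eq_card => x; rewrite !inE ffunE.
  have [xX|xX] := boolP (x \in X).
    by have := subsetP XN x xX; rewrite inE => /eqP ->; rewrite !eqxx.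
  by case: (c x) => [j'|] /=; rewrite ?andbF // eq_sym nkl.
case: eqVneq => [->|njl].
  apply: eq_card => x; rewrite !inE ffunE; case: (c x) => [j'|]; rewrite ?andbF //=.
  by case: (x \in X); rewrite ?nkl ?eqxx.
apply/eqP; rewrite cards_eq0; apply/eqP/setP=> x; rewrite !inE ffunE.
by case: (c x) => [j'|]; rewrite ?andbF //=; case: ifP;
  rewrite eq_sym ?(negbTE njk) ?(negbTE njl).
Qed.

Lemma rowc_fill : rowc = fill c0 [set x in nones c0 | blk a x == i].
Proof.
rewrite {1}(refinesP (refines_garnir_col rowcE T k l)); congr fill.
by apply/setP=> x; rewrite !inE -val_eqE /= !rowcE.
Qed.

(** Lying in the orbit of [rowc] is a condition on letter counts, and only the counts of the two
    shuffled colours depend on [X]. *)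
Lemma fill_orbit w c (X : {set 'I_r}) : jorb T c0 w c -> X \subset nones c ->
  [exists s, fill c X == rp rowc s] = (#|X| == pulled).
Proof.
case/jorbP=> s [_ hc] XN.
have X0N : [set x in nones c0 | blk a x == i] \subset nones c0.
  by apply/subsetP=> x; rewrite inE => /andP[].
have cSome j : #|[set x | c x == Some j]| = #|[set x | c0 x == Some j]|.
  by rewrite hc (card_rp _ s (fun o => o == Some j)).
have cnones : #|nones c| = #|nones c0|.
  by rewrite /nones hc (card_rp _ s (fun o => o == None)).
have := card_fill _ X0N; rewrite -rowc_fill -/pulled => cnt0.
apply/existsP/eqP => [[t /eqP ht]|hX].
  have := card_fill (rowc k) XN; rewrite ht (card_rp _ t (fun j => j == rowc k)).
  by rewrite cnt0 eqxx cSome => /addnI.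
have [j|t ht] := @rp_of_counts _ _ (fill c X) rowc; last by exists t; rewrite ht.
rewrite cnt0 card_fill // cSome hX; case: eqP => // _; case: eqP => // _.
by rewrite !cardsDS // cnones hX.
Qed.

Lemma card_refinements t w c : jorb T c0 w c ->
  #|[set e | admissible t e && refines i e c]| =
  #|[set X : {set 'I_r} | [&& X \subset nones c, #|X| == pulled &
       [forall x, allowed t (fill c X x) x]]]|.
Proof.
move=> jc; rewrite -(card_in_imset (f := fill c)); last first.
  by move=> X Y; rewrite !inE => /andP[XN _] /andP[YN _]; apply: fill_inj.
apply: eq_card => e; rewrite inE; apply/idP/imsetP => [|[X + ->]].
  case/andP=> adm_e ref_e; exists [set x in nones c | e x == rowc k];
    last exact: refinesP.
  have XN : [set x in nones c | e x == rowc k] \subset nones c.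
    by apply/subsetP=> x; rewrite inE => /andP[].
  by rewrite inE XN -(fill_orbit jc XN) -refinesP.
rewrite inE => /and3P[XN hX al]; rewrite refines_fill andbT /admissible al andbT.
by rewrite (fill_orbit jc XN).
Qed.

Lemma pulled_le : (pulled <= nth 0 a i)%N.
Proof.
rewrite -(card_blk sum_a); apply/subset_leq_card/subsetP=> x.
by rewrite !inE => /andP[].
Qed.

Lemma rest_le w c : jorb T c0 w c -> (#|nones c| - pulled <= nth 0 a i.+1)%N.
Proof.
move=> jc; rewrite (card_jorb_None jc) -(card_blk sum_a) /pulled -cardsDS.
  apply/subset_leq_card/subsetP=> x; rewrite !inE => /andP[+ /eqP hx];
    rewrite hx eqxx /=.
  by case/orP: (garnir_col_None hx) => /andP[-> _].
by apply/subsetP=> x; rewrite !inE => /andP[].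
Qed.

Lemma lt_card_nones w c : jorb T c0 w c -> (nth 0 a i < #|nones c|)%N.
Proof. by move=> jc; rewrite (card_jorb_None jc); apply: card_garnir_None. Qed.

Variable p : nat.
Hypothesis pK : p \in [pchar K].

Lemma theta_garnir_eq0 t w :
  (forall c, jorb T c0 w c -> (p %| #|[set e | admissible t e && refines i e c]|)%N) ->
  theta t (garnir K a rowc T k l) w = 0.
Proof.
move=> h; rewrite theta_garnir big1 // => c _.
case: (boolP (jorb _ _ _ _)) => [/h|]; last by rewrite mul0r.
by rewrite (dvdn_pcharf pK) => /eqP ->; rewrite mulr0.
Qed.

(** Neither shuffled colour is 0 and both lie on the same side of [t], so whether a completion is
    allowed does not depend on [X]. With z hidden slots the count is 0 or C(z, pulled) = C(z, z -
    pulled). *)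
Lemma theta_garnir_far t w : i != 0%N -> (i.+1 < t)%N || (t <= i)%N ->
  (forall q, (0 < q <= nth 0 a i.+1)%N -> (p %| 'C(nth 0 a i + q, q))%N) ->
  theta t (garnir K a rowc T k l) w = 0.
Proof.
move=> i0 hit hp; apply: theta_garnir_eq0 => c jc; rewrite (card_refinements _ jc).
have alE (X : {set 'I_r}) x : allowed t (fill c X x) x = allowed t (fill c set0 x) x.
  rewrite !ffunE; case: (c x) => // ; rewrite inE; case: (x \in X) => //.
  rewrite /allowed !rowcE blk_l (negbTE i0) /=; congr (_ ==> _).
  by move: hit; lia.
case: (boolP [forall x, allowed t (fill c set0 x) x]) => [/forallP al|nal].
  rewrite (_ : [set X | _] = [set X : {set 'I_r} | X \subset nones c & #|X| == pulled]).
    rewrite cards_draws; have lt_z := lt_card_nones jc; have le_p := pulled_le.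
    have le_q := rest_le jc.
    rewrite -bin_sub; last by lia.
    by apply: (dvdn_bin_shift hp) => //; lia.
  apply/setP=> X; rewrite !inE; case: (X \subset _) => //=; case: eqP => //= _.
  by apply/forallP=> x; rewrite alE.
rewrite (_ : [set X | _] = set0) ?cards0 ?dvdn0 //.
apply/setP=> X; rewrite !inE; apply: contraNF nal => /and3P[_ _ /forallP al].
by apply/forallP=> x; rewrite -(alE X).
Qed.

Definition coloured (P : pred nat) c : {set 'I_r} :=
  [set x | if c x is Some j then P (val j) else false].

Lemma card_coloured P w c : jorb T c0 w c -> #|coloured P c| = #|coloured P c0|.
Proof.
case/jorbP=> s [_ ->].
exact: (card_rp _ s (fun o => if o is Some j then P (val j) else false)).
Qed.

Lemma coloured_garnir P : ~~ P i -> ~~ P i.+1 -> coloured P c0 = [set x | P (blk a x)].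
Proof.
move=> nPi nPi1; apply/setP=> x; rewrite !inE.
case hx: (c0 x) => [j|]; first by rewrite (garnir_col_Some hx) /= rowcE.
apply/esym/negbTE.
by case/orP: (garnir_col_None hx) => /andP[/eqP -> _].
Qed.

Lemma coloured_garnir_row : (#|coloured (pred1 i) c0| + pulled = nth 0 a i)%N.
Proof.
rewrite -(card_blk sum_a) -(cardsID (nones c0) [set x | blk a x == i]) addnC.
congr (_ + _)%N; apply: eq_card => x; rewrite !inE; first by rewrite andbC.
case hx: (c0 x) => [j|] //=; by rewrite (garnir_col_Some hx) /= rowcE.
Qed.

Lemma blk_lt2 (x : 'I_r) : (blk b x < 2)%N.
Proof.
rewrite ltnNge; apply/negP => h; have := off_lt_nth sum_b x.
by rewrite ltnNge (leq_trans (sorted_geq_nth sorted_b h)) ?b_two.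
Qed.

Lemma card_top : #|top| = nth 0%N b 0.
Proof. exact: card_blk. Qed.

Lemma card_bottom : #|~: top| = nth 0%N b 1.
Proof.
rewrite -(card_blk sum_b); apply: eq_card => x; rewrite !inE.
by have := blk_lt2 x; case: (blk b x) => [|[]].
Qed.

(** Colour 2 is confined to the bottom row and colour 1 is free, so a completion is a choice of the
    slots of colour 2 among the hidden bottom slots. *)
Lemma theta_garnir_near w : i = 1%N -> (nth 0 a 0 <= nth 0 b 0)%N ->
  (nth 0 b 0 - nth 0 a 0 <= nth 0 a 1)%N ->
  (forall q, (0 < q <= nth 0 a 2)%N ->
     (p %| 'C(nth 0 a 1 - (nth 0 b 0 - nth 0 a 0) + q, q))%N) ->
  theta 2 (garnir K a rowc T k l) w = 0.
Proof.
move=> i1 le_ab le_d hp; apply: theta_garnir_eq0 => c jc;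
  rewrite (card_refinements _ jc).
set S := [set X | _]; have [->|[X0]] := set_0Vmem S; first by rewrite cards0 dvdn0.
rewrite inE => /and3P[X0N _ /forallP al0].
have le_pz : (pulled <= #|nones c|)%N.
  exact: leq_trans pulled_le (ltnW (lt_card_nones jc)).
have alSome x j : c x = Some j -> allowed 2 j x.
  by move=> hx; have := al0 x; rewrite ffunE hx.
have fillE (X : {set 'I_r}) : X \subset nones c ->
    [forall x, allowed 2 (fill c X x) x] = (nones c :\: X \subset ~: top).
  move=> XN; apply/forallP/subsetP => [al x|al x].
    rewrite !inE => /andP[xX /eqP hx]; have := al x.
    by rewrite ffunE hx (negbTE xX) /allowed rowcE blk_l i1 inE.
  rewrite ffunE; case hx: (c x) => [j|]; first exact: alSome.
  case: ifP => xX; rewrite /allowed rowcE ?blk_l i1 //=.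
  by have := al x; rewrite !inE xX hx => /(_ isT).
have -> : S = [set nones c :\: D | D : {set 'I_r} in
    [set D : {set 'I_r} | D \subset nones c :\: top & #|D| == #|nones c| - pulled]]%N.
  apply/setP=> X; rewrite inE; apply/idP/imsetP => [/and3P[XN /eqP hX]|[D + ->]].
    rewrite fillE // => hD; exists (nones c :\: X).
      by rewrite inE cardsDS // hX eqxx andbT [nones c :\: top]setDE subsetI hD
        subsetDl.
    by rewrite setDDr setDv set0U; apply/esym/setIidPr.
  rewrite inE subsetD => /andP[/andP[DN Dt] /eqP hD].
  rewrite subsetDl cardsDS // hD subKn // eqxx /=.
  rewrite fillE ?subsetDl // setDDr setDv set0U (setIidPr DN).
  by rewrite subsets_disjoint setCK.
rewrite card_in_imset => [|D D']; last first.
  rewrite !inE !subsetD =>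
    /andP[/andP[DN _] _] /andP[/andP[DN' _] _] /(congr1 (setD (nones c))).
  by rewrite !setDDr !setDv !set0U (setIidPr DN) (setIidPr DN').
rewrite cards_draws.
have le_q := rest_le jc; have lt_z := lt_card_nones jc; have le_p := pulled_le.
have row1 := coloured_garnir_row; rewrite i1 in le_q lt_z le_p row1.
have row0 : #|coloured (pred1 0%N) c| = nth 0%N a 0.
  by rewrite (card_coloured _ jc) coloured_garnir ?i1 // card_blk.
rewrite -(card_coloured _ jc) in row1.
have cT := card_top; have zE := cardsID top (nones c).
(* Colour 0 and the hidden top slots fit into the top row, and together with colour 1 they cover it.
   These two bounds are the range conditions of [dvdn_bin_shift]. *)
have sub0 : (#|coloured (pred1 0%N) c| + #|nones c :&: top| <= #|top|)%N.
  rewrite -cardsUI (_ : _ :&: (_ :&: _) = set0) ?cards0 ?addn0.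
    apply/subset_leq_card/subsetP=> x; rewrite !inE.
    case hx: (c x) => [j|] /=; last by [].
    by rewrite orbF => /eqP j0; have := alSome x j hx; rewrite /allowed inE /= j0 andbT.
  by apply/setP=> x; rewrite !inE; case: (c x) => [j|]; rewrite ?andbF.
have sub1 : (#|top| <= #|coloured (pred1 0%N) c| + #|coloured (pred1 1%N) c| +
  #|nones c :&: top|)%N.
  rewrite (leq_trans _ (leq_add (leq_card_setU _ _) (leqnn _))) //.
  rewrite (leq_trans _ (leq_card_setU _ _)) //.
  apply/subset_leq_card/subsetP=> x; rewrite !inE => xt.
  case hx: (c x) => [j|] /=; last by rewrite xt ?orbT.
  have := alSome x j hx; rewrite /allowed inE xt /= implybF -ltnNge => /andP[_].
  by case: (val j) => [|[]].
apply: (dvdn_bin_shift hp) => //; lia.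
Qed.

(** * Garnir elements of the first two rows *)

Section FirstRows.
Variables (t bn : nat).
Hypotheses (i0 : i = 0%N) (t2 : (2 <= t)%N).
Hypothesis bnE : (bn + #|[set x : 'I_r | (t <= blk a x)%N]| = nth 0 b 1)%N.
Hypothesis bn_le : (bn <= nth 0 a 0)%N.
Local Notation ones := (coloured (pred1 0%N)).
Local Notation late := (coloured (leq t)).

Definition fits c (B Y : {set 'I_r}) : bool :=
  [&& nones c \subset Y, Y \subset nones c :|: ones c,
      Y \subset B & late c \subset ~: B].

(** The share of [B] after inclusion-exclusion over the slots of colour 0 and Vandermonde over the
    bottom row. It sees [B] only through its size and its union with [top], whence [weight_rp]. *)
Definition weight c (B : {set 'I_r}) : K :=
  \sum_(Y | fits c (top :|: B) Y)
    (-1) ^+ #|ones c :\: Y| * 'C(#|Y| - bn, nth 0%N a 0 - bn + #|B|)%:R.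

(** The count is C(|nones c :&: top|, pulled) if colour 0 lies in the top row and the colours from
    [t] on in the bottom row, and 0 otherwise. [sum_signed_bin_subsets] absorbs the condition on
    colour 0; [sum_bin_subsets] then replaces |Y :&: top| by |Y|. *)
Lemma card_refinements_weight w c : jorb T c0 w c ->
  #|[set e | admissible t e && refines i e c]|%:R =
  \sum_(B : {set 'I_r} | B \subset ~: top) weight c B.
Proof.
move=> jc; rewrite (card_refinements _ jc).
have lt_z := lt_card_nones jc; rewrite i0 in lt_z.
have ones_pulled : (#|ones c| + pulled = nth 0 a 0)%N.
  by have := coloured_garnir_row; rewrite i0 (card_coloured _ jc).
have card_late : #|late c| = #|[set x : 'I_r | (t <= blk a x)%N]|.
  by rewrite (card_coloured _ jc) coloured_garnir // i0 -ltnNge // ltnW.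
have dis_ones : nones c :&: ones c = set0.
  by apply/setP=> x; rewrite !inE; case: (c x).
have dis_late : (nones c :|: ones c) :&: late c = set0.
  apply/setP=> x; rewrite !inE; case: (c x) => [j|] //=.
  by case: eqP => [->|] //; rewrite leqNgt ltnW.
have [late_bot|late_top] := boolP (late c \subset ~: top); last first.
  rewrite (_ : [set X | _] = set0) ?cards0 => [|].
    rewrite big1 // => B _; apply: big_pred0 => Y; apply/negbTE.
    apply: contra late_top => /and4P[_ _ _].
    by rewrite setCU subsetI => /andP[].
  apply/setP=> X; rewrite !inE; apply: contraNF late_top => /and3P[_ _ /forallP al].
  apply/subsetP=> x; rewrite inE; case hx: (c x) => [j|] // tj.
  by have := al x; rewrite ffunE hx /allowed tj /= => /andP[_]; rewrite !inE.
transitivity ((if ones c \subset top then 'C(#|nones c :&: top|, pulled)%:R else 0)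
  : K).
  case: (boolP (ones c \subset top)) => ones_top.
    rewrite -cards_draws; congr (_%:R); apply: eq_card => X; rewrite !inE subsetI.
    case XN: (X \subset nones c) => //=; rewrite andbC; congr (_ && _).
    apply/forallP/subsetP => [al x xX|Xtop x].
      have := subsetP XN x xX; rewrite inE => /eqP hx; have := al x.
      by rewrite ffunE hx xX /allowed rowcE i0 /= => /andP[].
    rewrite ffunE; case hx: (c x) => [j|].
      apply/andP; split; apply/implyP=> hj.
        by apply: (subsetP ones_top); rewrite inE hx.
      by have := subsetP late_bot x; rewrite !inE hx; apply.
    case: ifP => [/Xtop xt|_]; rewrite /allowed rowcE ?blk_l i0 /= ?xt //.
      by rewrite leqNgt (ltnW t2).
    by rewrite leqNgt t2.
  rewrite (_ : [set X | _] = set0) ?cards0 //.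
  apply/setP=> X; rewrite !inE; apply: contraNF ones_top => /and3P[_ _ /forallP al].
  apply/subsetP=> x; rewrite inE; case hx: (c x) => [j|] // /eqP j0.
  by have := al x; rewrite ffunE hx /allowed /= j0 => /andP[].
(* [bn] is the number of bottom slots left free by the late colours. *)
have card_bot : #|~: top :\: late c| = bn.
  by rewrite cardsDS // card_bottom -bnE card_late addnK.
rewrite /weight (exchange_big_dep (fun Y : {set 'I_r} =>
  (nones c \subset Y) && (Y \subset nones c :|: ones c))) /=; last first.
  by move=> B Y _ /and4P[-> ->].
rewrite (eq_bigr (fun Y : {set 'I_r} =>
  (-1) ^+ #|ones c :\: Y| * 'C(#|Y :&: top|, nth 0%N a 0)%:R)).
  rewrite sum_interval ?subsetUl // setDUl setDv set0U (_ : _ :\: _ = ones c);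
    last first.
    by apply/setDidPl; rewrite -setI_eq0 setIC dis_ones.
  under eq_bigr => D DU.
    rewrite -setDDl (_ : ones c :\: nones c = ones c); last first.
      by apply/setDidPl; rewrite -setI_eq0 setIC dis_ones.
    rewrite setIUl cardsU (_ : _ :&: (D :&: top) = set0) ?cards0 ?subn0; last first.
      apply/eqP; rewrite -subset0 -dis_ones; apply/subsetP=> x; rewrite !inE.
      by case/andP=> /andP[-> _] /andP[xD _]; have := subsetP DU x xD; rewrite inE.
    over.
  rewrite sum_signed_bin_subsets; last by lia.
  by rewrite -ones_pulled addKn.
move=> Y /andP[NY YU].
have Y_late : Y :&: late c = set0.
  by apply/eqP; rewrite -subset0 -dis_late setSI.
have LU : Y :\: top \subset ~: top :\: late c.
  apply/subsetP=> x; rewrite !inE => /andP[-> xY]; rewrite andbT.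
  by have := in_set0 x; rewrite -Y_late !inE xY /= => ->.
rewrite (eq_bigl (fun B : {set 'I_r} =>
  (Y :\: top \subset B) && (B \subset ~: top :\: late c))); last first.
  move=> B; rewrite /fits NY YU /= subDset setCU subsetI late_bot /=.
  have -> : (late c \subset ~: B) = [disjoint B & late c].
    by rewrite -disjoints_subset disjoint_sym.
  by rewrite subsetD andbCA.
rewrite sum_interval // -mulr_sumr -natr_sum; congr (_ * _%:R).
have Ycard := cardsID top Y.
have le_bn : (bn <= #|Y|)%N.
  by apply: leq_trans (leq_trans bn_le (ltnW lt_z)) (subset_leq_card NY).
have le_L := subset_leq_card LU; rewrite card_bot in le_L.
transitivity (\sum_(D : {set 'I_r} | D \subset (~: top :\: late c) :\: (Y :\: top))
    'C(#|Y| - bn, (nth 0 a 0 - bn + #|Y :\: top|) + #|D|))%N.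
  apply: eq_bigr => D; rewrite subsetD => /andP[_ dD].
  by rewrite cardsU disjoint_setI0 1?disjoint_sym // cards0 subn0 addnA.
rewrite sum_bin_subsets cardsDS // card_bot.
by congr binomial; move: Ycard le_bn le_L bn_le; clear; lia.
Qed.

Lemma fits_rp c (s : 'S_r) (B Y : {set 'I_r}) :
  fits (rp c s) (s @^-1: B) (s @^-1: Y) = fits c B Y.
Proof.
have sub (A D : {set 'I_r}) : (s @^-1: A \subset s @^-1: D) = (A \subset D).
  apply/subsetP/subsetP => h x; last by rewrite !inE; apply: h.
  by have := h (s^-1%g x); rewrite !inE permKV.
have colE P : coloured P (rp c s) = s @^-1: coloured P c.
  by apply/setP=> x; rewrite !inE rpE.
have nE : nones (rp c s) = s @^-1: nones c by apply/setP=> x; rewrite !inE rpE.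
by rewrite /fits nE !colE -preimsetU -preimsetC !sub.
Qed.

Lemma weight_rp c (s : 'S_r) (B : {set 'I_r}) : s @^-1: (top :|: B) = top :|: B ->
  weight (rp c s) B = weight c B.
Proof.
move=> hB; rewrite /weight (reindex (fun Y : {set 'I_r} => s @^-1: Y)) /=; last first.
  exists (fun Y : {set 'I_r} => s^-1%g @^-1: Y) => Y _; apply/setP=> x.
    by rewrite !inE permKV.
  by rewrite !inE permK.
apply: eq_big => [Y|Y _]; first by rewrite -{1}hB fits_rp.
rewrite (card_preimset _ (@perm_inj _ s)).
have -> : ones (rp c s) :\: s @^-1: Y = s @^-1: (ones c :\: Y).
  by apply/setP=> x; rewrite !inE rpE.
by rewrite (card_preimset _ (@perm_inj _ s)).
Qed.

Lemma bottom_mate x : x \notin top ->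
  exists y, [/\ y \in top, x != y & off b x = off b y].
Proof.
rewrite inE => x0; have x1 : blk b x = 1%N.
  by move: x0 (blk_lt2 x); case: (blk b x) => [|[]].
have [|y [hy1 hy2]] := @box_exists r b sum_b 0 (off b x).
  apply: leq_trans (off_lt_nth sum_b x) _.
  by rewrite x1; apply: sorted_geq_nth.
exists y; split; rewrite ?inE ?hy1 //.
by apply/eqP=> e; move: x1; rewrite e hy1.
Qed.

(** A box of a nonempty [B] and the top box of its column both lie in [top :|: B], so exchanging
    them preserves the weights. For empty [B] the coefficients vanish in [K]. *)
Lemma theta_garnir_first :
  (forall q, (0 < q <= nth 0 b 0 - nth 0 a 0)%N -> (p %| 'C(nth 0 a 0 - bn + q,
    q))%N) ->
  forall w, altsum (off b) (theta t (garnir K a rowc T k l)) w = 0.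
Proof.
move=> hp w.
pose G B : tpow K n r := [ffun u => \sum_c (jorb T c0 u c)%:R * weight c B].
have -> : altsum (off b) (theta t (garnir K a rowc T k l)) w =
    \sum_(B : {set 'I_r} | B \subset ~: top) altsum (off b) (G B) w.
  rewrite exchange_big; apply: eq_bigr => s _; rewrite -mulr_sumr; congr (_ * _).
  rewrite theta_garnir.
  rewrite [RHS](eq_bigr (fun B =>
    \sum_c (jorb T c0 (rp w s) c)%:R * weight c B)) => [|B _]; last by rewrite ffunE.
  rewrite exchange_big; apply: eq_bigr => c _.
  case: (boolP (jorb T c0 (rp w s) c)) => [jc|_]; last by rewrite mul0r big1 // =>
    *; rewrite mul0r.
  by rewrite (card_refinements_weight jc) mulr_sumr.
apply: big1 => B Bbot; have [->|[x xB]] := set_0Vmem B.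
  apply: big1 => s _; rewrite ffunE big1 ?mulr0 // => c _.
  case: (boolP (jorb _ _ _ _)) => [jc|]; last by rewrite mul0r.
  rewrite mul1r; apply: big1 => Y; rewrite /fits setU0 => /and4P[NY _ Ytop _].
  have lt_z := lt_card_nones jc; rewrite i0 in lt_z.
  have := subset_leq_card NY; have := subset_leq_card Ytop;
    rewrite card_top cards0 addn0 => le1 le2.
  rewrite [X in _ * X](_ : _ = 0) ?mulr0 //; apply/eqP; rewrite -(dvdn_pcharf pK).
  (* [Y] contains the hidden slots, more than [nth 0 a 0] of them, and lies in [top]; so q = |Y| -
     [nth 0 a 0] is in the range of [hp]. *)
  have -> : (#|Y| - bn = nth 0 a 0 - bn + (#|Y| - nth 0 a 0))%N by lia.
  by rewrite -bin_sub ?leq_addr // addKn; apply: hp; lia.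
have := subsetP Bbot x xB; rewrite in_setC => /bottom_mate[y [ytop nxy oxy]].
apply: (altsum_sym_eq0 nxy oxy) => u; rewrite !ffunE.
rewrite (reindex_inj (@rp_inj _ _ (tperm x y))) /=; apply: eq_bigr => c _.
rewrite jorb_rp weight_rp //; apply/setP=> z; rewrite !inE.
rewrite inE in ytop.
by case: tpermP => [->|->|//]; rewrite ytop xB ?orbT.
Qed.

End FirstRows.

End OnGarnir.
End Theta.

(** * Homomorphisms into a two-rowed Weyl module *)

Section TwoRows.
Variables (K : fieldType) (n r : nat) (a b : seq nat).
Hypotheses (sum_a : sumn a = r) (sorted_a : sorted geq a).
Hypotheses (sum_b : sumn b = r) (sorted_b : sorted geq b).
Hypothesis b_two : nth 0%N b 2 = 0%N.
Variable rowc : word n r.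
Hypothesis rowcE : forall k, rowc k = blk a k :> nat.
Local Notation theta := (theta K b rowc).

Lemma theta_ker t :
  (forall (T : Dbasis n r a) k l, violation a (val T) k l ->
     forall w, altsum (off b) (theta t (garnir K a rowc (val T) k l)) w = 0) ->
  forall x : Dspace K n r a, dprime K n r a x = 0 -> induced a b (theta t) x = 0.
Proof.
move=> h; apply: (ker_dprime sum_a sorted_a rowcE) => T k l hv.
rewrite inducedE restrDK; last exact: garnir_yinv.
by apply/eqP/mult_rearr_eq0P => //; apply: h.
Qed.

Lemma altsum_lincomb (kap : 'I_r -> nat) (z : K) (f g : tpow K n r) w :
  altsum kap (f - z *: g) w = altsum kap f w - z * altsum kap g w.
Proof.
rewrite /altsum mulr_sumr -sumrB; apply: eq_bigr => s _.
by rewrite !ffunE mulrBr mulrCA.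
Qed.

(** The tensor product of the divided powers of the e_i, with exponent the length of row i: the
    standard generator of D(a). *)
Definition generator : Dspace K n r a := restrD a [ffun w => (w == rowc)%:R].

Lemma theta_generator t w :
  theta t (comult K n r a generator) w = (admissible b rowc t w)%:R.
Proof.
rewrite restrDK => [|u s hs]; last first.
  rewrite !ffunE -{1}(rowc_keeps rowcE hs) (inj_eq (@rp_inj _ _ s)) //.
rewrite thetaE (eq_bigr (fun e => (w == e)%:R)) => [|e /andP[/existsP[s /eqP he] _]].
  case: (boolP (admissible b rowc t w)) => hw.
    rewrite (bigD1 w) //= eqxx big1 ?addr0 // => e /andP[_ /negbTE ne].
    by rewrite eq_sym ne.
  by apply: big1 => e he; case: eqP => // ew; rewrite ew he in hw.
rewrite ffunE /straightening_perm; case: pickP => [g /eqP hg|/(_ s)];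
  last by rewrite he eqxx.
by rewrite /= hg -(inj_eq (@rp_inj _ _ g)) rpVK.
Qed.

(** All columns of length two have 0 at the top, so a nontrivial column permutation moves a 0 to the
    bottom row, where it is not allowed. *)
Lemma altsum_generator t (w : word n r) :
  (forall x y : 'I_r, blk b x != 0%N -> blk b y = 0%N -> off b x = off b y -> w y =
    0%N :> nat) ->
  altsum (off b) (theta t (comult K n r a generator)) w = (admissible b rowc t w)%:R.
Proof.
move=> hw; rewrite /altsum (bigD1 1%g) ?keeps1 //= rp1 theta_generator odd_perm1 mul1r.
rewrite big1 ?addr0 // => s /andP[/keepsP hs ns1]; rewrite theta_generator.
case: (boolP (admissible _ _ _ _)) => [/andP[_ /forallP al]|]; last by rewrite mulr0.
case/eqP: ns1; apply/permP=> x; rewrite perm1.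
have b2 (y : 'I_r) : (blk b y < 2)%N by exact: (blk_lt2 sum_b sorted_b b_two).
have fix_bot z : blk b z != 0%N -> s z = z.
  move=> z0; apply: (box_inj (a := b)) => //.
  have sz0 : blk b (s z) != 0%N.
    apply/eqP=> sz0; have := al z; rewrite rpE /allowed !inE (negbTE z0) implybF =>
      /andP[/eqP + _].
    by case; apply: (hw z).
  by move: (b2 z) (b2 (s z)) z0 sz0; case: (blk b z) => [|[]] //;
    case: (blk b (s z)) => [|[]].
have [x0|] := eqVneq (blk b x) 0%N; last exact: fix_bot.
have [sx0|/fix_bot/perm_inj//] := eqVneq (blk b (s x)) 0%N.
by apply: (box_inj (a := b)); rewrite ?sx0 ?x0 ?hs.
Qed.

End TwoRows.

(** * Two linearly independent homomorphisms *)

Lemma dim_ge2 (K : fieldType) (V : vectType K) (W : {vspace V}) (f g : V) :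
  f \in W -> g \in W -> g != 0 -> (forall z, f != z *: g) -> (2 <= \dim W)%N.
Proof.
move=> fW gW g0 fg; have free_fg : free [:: f; g].
  rewrite free_cons seq1_free g0 andbT span_seq1.
  by apply/vlineP => -[z e]; have := fg z; rewrite e eqxx.
rewrite -[2%N]/(size [:: f; g]) -(eqP free_fg); apply: dimvS.
by apply/span_subvP => v; rewrite !inE => /orP[] /eqP ->.
Qed.

Theorem corollary6p2 (K : fieldType) (p n r m : nat) (lam mu : n.-tuple nat)
    (d := (part mu 1 - part lam 1)%N) :
  ~ (exists s : seq K, forall x : K, x \in s) ->
  p \in [pchar K]%R ->
  (0 < r)%N -> (r <= n)%N ->
  lam \in partitions n r -> mu \in partitions n r ->
  (3 <= m)%N -> part lam m != 0%N -> part lam m.+1 = 0%N ->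
  part mu 3 = 0%N ->
  (0 < d)%N -> (d <= part lam 2 - part lam 3)%N ->
  (part mu 2 <= part lam 1)%N ->
  (p %| Rgcd (part lam 1 - part mu 2 + 1) d)%N ->
  (forall i : nat, (2 <= i <= m - 1)%N ->
     (p %| Rgcd (part lam i + 1) (part lam i.+1))%N) ->
  (p %| Rgcd (part lam 1 - part lam 2 + d + 1) d)%N ->
  (p %| Rgcd (part lam 2 - d + 1) (part lam 3))%N ->
  (2 <= \dim (HomS K n r lam mu))%N.
Proof.
move=> _ pK _ _ /andP[sorted_a /eqP sum_a] /andP[sorted_b /eqP sum_b].
rewrite /part /= in d *; set e := (nth 0 mu 0 - nth 0 lam 0)%N =>
  m3 lam_m lam_m1 mu3 d0 le_d le_mu2 hp1 hp2 hp3 hp4.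
have {}hp1 := elimT (dvdn_RgcdP _ _ _) hp1.
have {}hp2 i : (2 <= i <= m - 1)%N -> _ := fun hi =>
  elimT (dvdn_RgcdP _ _ _) (hp2 i hi).
have {}hp3 := elimT (dvdn_RgcdP _ _ _) hp3.
have {}hp4 := elimT (dvdn_RgcdP _ _ _) hp4.
have blk_ltn (k : 'I_r) : (blk lam k < n)%N by have := blk_lt_size sum_a k;
  rewrite size_tuple.
pose rowc : word n r := [ffun k => Ordinal (blk_ltn k)].
have rowcE k : rowc k = blk lam k :> nat by rewrite ffunE.
have lam3 : (0 < nth 0 lam 2)%N.
  by have := sorted_geq_nth sorted_a (_ : 2 <= m.-1)%N; lia.
have lam12 : (nth 0 lam 1 <= nth 0 lam 0)%N by apply: sorted_geq_nth.
have lam23 : (nth 0 lam 2 <= nth 0 lam 1)%N by apply: sorted_geq_nth.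
have n3 : (2 < n)%N.
  by rewrite ltnNge; apply/negP => h; rewrite nth_default ?size_tuple in lam3.
have sum_mu : (nth 0 mu 0 + nth 0 mu 1 = r)%N.
  by rewrite -(card_top sum_b) -(card_bottom sum_b sorted_b mu3) cardsC card_ord.
have row_m i : (0 < nth 0 lam i)%N -> (i < m)%N.
  move=> h; rewrite ltnNge; apply/negP=> mi; have := sorted_geq_nth sorted_a mi; lia.
have far (T : Dbasis n r lam) k l t : violation lam (val T) k l -> blk lam k != 0%N ->
    ((blk lam k).+1 < t)%N || (t <= blk lam k)%N ->
    forall w, altsum (off mu) (theta K mu rowc t (garnir K lam rowc (val T) k l)) w = 0.
  move=> hv k0 ht w; apply: big1 => s _.
  rewrite (theta_garnir_far sum_a sorted_a sum_b sorted_b mu3 rowcE hv _ pK) ?mulr0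
    //; first exact/wincrP/(valP T).
  (* [blk] numbers rows from 0 and the hypotheses from 1, whence the successor. *)
  move=> q /andP[q0 qle]; apply: (hp2 (blk lam k).+1).
    by have := row_m _ (leq_trans q0 qle); lia.
  by rewrite q0.
have first (T : Dbasis n r lam) k l t bn : violation lam (val T) k l -> blk lam k =
  0%N ->
    (2 <= t)%N -> (bn + #|[set x : 'I_r | (t <= blk lam x)%N]| = nth 0 mu 1)%N ->
    (bn <= nth 0 lam 0)%N ->
    (forall q, (0 < q <= e)%N -> (p %| 'C(nth 0 lam 0 - bn + q, q))%N) ->
    forall w, altsum (off mu) (theta K mu rowc t (garnir K lam rowc (val T) k l)) w = 0.
  move=> hv k0 t2 hbn le_bn hp w.
  by apply: (theta_garnir_first sum_a sorted_a sum_b sorted_b mu3 rowcE hv _ pK k0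
    t2 hbn le_bn hp); exact/wincrP/(valP T).
have ker_all t : (t = n \/ t = 2%N) -> forall x : Dspace K n r lam,
    dprime K n r lam x = 0 -> induced lam mu (theta K mu rowc t) x = 0.
  move=> ht; apply: (theta_ker sum_a sorted_a sum_b sorted_b rowcE) => T k l hv.
  have [k0|k0] := eqVneq (blk lam k) 0%N; last first.
    case: ht => ->; first by apply: far => //; case/and3P: hv => /eqP <- _ _;
      rewrite blk_ltn.
    (* For [t = 2] only the colours 1 and 2 are separated by [t]; that case uses [hp4]. *)
    have [k1|k1] := eqVneq (blk lam k) 1%N; last first.
      by apply: far => //; move: k0 k1; case: (blk lam k) => [|[]].
    move=> w; apply: big1 => s _.
    rewrite (theta_garnir_near sum_a sorted_a sum_b sorted_b mu3 rowcE hv _ pK)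
      ?mulr0 //.
    - exact/wincrP/(valP T).
    - by rewrite /e in d0; lia.
    - by rewrite -/e; lia.
  case: ht => ->.
    (* For [t = n] no colour is late, so [bn] is mu_2 and [hp1] applies. *)
    apply: (first T k l n (nth 0 mu 1)%N) => //; first exact: ltnW.
    rewrite (_ : [set x | _] = set0) ?cards0 ?addn0 //.
    by apply/setP=> x; rewrite !inE leqNgt blk_ltn.
  (* For [t = 2] there are r - lam_1 - lam_2 late slots, which leaves lam_2 - d free bottom slots;
     [hp3] is the matching divisibility. *)
  apply: (first T k l 2%N (nth 0 lam 1 - e)%N) => //.
  - have := cardsC [set x : 'I_r | (blk lam x < 2)%N]; rewrite card_ord.
    have -> : #|[set x : 'I_r | (blk lam x < 2)%N]| = (nth 0 lam 0 + nth 0 lam 1)%N.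
      rewrite -(card_blk sum_a) -[in X in (_ = _ + X)%N](card_blk sum_a).
      rewrite -cardsUI (_ : _ :&: _ = set0) ?cards0 ?addn0.
        by apply: eq_card => x; rewrite !inE; case: (blk lam x) => [|[]].
      by apply/setP=> x; rewrite !inE; case: (blk lam x) => [|[]].
    rewrite (_ : ~: _ = [set x : 'I_r | (2 <= blk lam x)%N]); last first.
      by apply/setP=> x; rewrite !inE -leqNgt.
    by move: sum_mu le_d d0; rewrite /e; clear; lia.
  - by move: lam12; clear; lia.
  - move=> q hq; have := hp3 q hq;
    rewrite (_ : _ - _ + e = nth 0 lam 0 - (nth 0 lam 1 - e))%N //.
    by move: lam12 le_d; clear; lia.
pose hom t := whom lam mu (theta K mu rowc t).
have hom_mem t : (t = n \/ t = 2%N) -> hom t \in HomS K n r lam mu.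
  move=> ht; apply: whom_HomS => //; last exact: ker_all.
  - by move=> x f xS; apply: theta_schur.
  - by move=> f; apply: theta_yinv.
pose u0 := vsproj (Weyl K n r lam) (dprime K n r lam (generator K lam rowc)).
have hom_u0 t : (t = n \/ t = 2%N) ->
    vsval (hom t u0) = induced lam mu (theta K mu rowc t) (generator K lam rowc).
  move=> ht; apply: whomE; [by move=> f; apply: theta_yinv|exact: ker_all|].
  by rewrite vsprojK ?dprime_Weyl.
pose psi t : tpow K n r := theta K mu rowc t (comult K n r lam (generator K lam rowc)).
(* As mu_2 <= lam_1, a top box above a bottom box is among the first lam_1 slots, where [rowc] is
   0. *)
have low (x y : 'I_r) : blk mu x != 0%N -> blk mu y = 0%N -> off mu x = off mu y ->
    (y < nth 0 lam 0)%N.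
  move=> x0 y0 oxy; rewrite (box_val mu y) y0 take0 /= -oxy.
  apply: leq_trans (off_lt_nth sum_b x) (leq_trans _ le_mu2).
  by apply: sorted_geq_nth => //; rewrite lt0n.
have good0 (x y : 'I_r) : blk mu x != 0%N -> blk mu y = 0%N -> off mu x = off mu y ->
    rowc y = 0%N :> nat.
  by move=> x0 y0 oxy; rewrite rowcE; apply/eqP; rewrite blk0_val //; apply: low oxy.
have lam2 : (0 < nth 0 lam 1)%N by apply: leq_trans lam23.
(* w1 has colour 2 in the top row, so that only the first family contains it. *)
have [y1 [y1b y1o]] := box_exists sum_a lam2.
have [y2 [y2b y2o]] := box_exists sum_a lam3.
(* Both diagrams number the same slots: [y1] is slot lam_1 < mu_1, hence in the top row of mu. *)
have y1v : y1 = nth 0%N lam 0 :> nat.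
  rewrite (box_val lam y1) y1b y1o addn0; case: (val lam) => [|v s] //=.
  by rewrite take0 /= addn0.
have le_y2 : (nth 0 lam 0 + nth 0 lam 1 <= y2)%N by apply: blk_ge2_val; rewrite y2b.
have mu0 : nth 0%N mu 0 = (nth 0 lam 0 + e)%N by move: d0; rewrite /e; clear; lia.
pose w1 := rp rowc (tperm y1 y2).
have low_fix (y : 'I_r) : (y < nth 0 lam 0)%N -> w1 y = rowc y.
  move=> ylow; rewrite rpE tpermD // -val_eqE /=.
    by rewrite y1v gtn_eqF.
  by rewrite gtn_eqF // (leq_trans ylow) // (leq_trans _ le_y2) // leq_addr.
have good1 (x y : 'I_r) : blk mu x != 0%N -> blk mu y = 0%N -> off mu x = off mu y ->
    w1 y = 0%N :> nat.
  by move=> x0 y0 oxy; rewrite low_fix ?(good0 x y) //; apply: low oxy.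
have allowed0 (x : 'I_r) : blk lam x = 0%N -> x \in top r mu.
  move/eqP; rewrite blk0_val // => lt_x; rewrite inE blk0_val // mu0.
  exact: leq_trans lt_x (leq_addr _ _).
have adm0 t : (t = n \/ t = 2%N) -> admissible mu rowc t rowc.
  move=> ht; apply/andP; split; first by apply/existsP; exists 1%g; rewrite rp1.
  apply/forallP=> x; rewrite /allowed rowcE; apply/andP; split.
    by apply/implyP=> /eqP; apply: allowed0.
  case: ht => ->; first by rewrite leqNgt blk_ltn.
  (* Colours from 2 on start at slot lam_1 + lam_2, which is at least mu_1 because d <= lam_2. *)
  apply/implyP=> /blk_ge2_val hx; rewrite inE blk0_val // mu0 -leqNgt.
  by apply: leq_trans hx; rewrite leq_add2l; move: le_d; clear; lia.
have adm1n : admissible mu rowc n w1.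
  apply/andP; split; first by apply/existsP; exists (tperm y1 y2).
  apply/forallP=> x; rewrite /allowed leqNgt ltn_ord andbT; apply/implyP.
  rewrite rpE rowcE; case: tpermP => [_|_|_ _]; rewrite ?y1b ?y2b // => /eqP.
  exact: allowed0.
have adm12 : ~~ admissible mu rowc 2 w1.
  rewrite negb_and; apply/orP; right; apply/forallPn; exists y1.
  rewrite /allowed rpE tpermL rowcE y2b /= negbK inE blk0_val // y1v mu0.
  by rewrite -[X in (X < _)%N]addn0 ltn_add2l.
have val1 t : altsum (off mu) (psi t) w1 = (admissible mu rowc t w1)%:R :> K.
  exact: altsum_generator.
have val0 t : altsum (off mu) (psi t) rowc = (admissible mu rowc t rowc)%:R :> K.
  exact: altsum_generator.
have altsum0 f : mult K n r (conj_part mu) (rearr K n r mu f) = 0 ->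
    forall w, altsum (off mu) f w = 0.
  by move=> /eqP/mult_rearr_eq0P; apply.
have tn : n = n \/ n = 2%N by left.
have t2 : 2%N = n \/ 2%N = 2%N by right.
apply: (dim_ge2 (hom_mem _ tn) (hom_mem _ t2)) => [|z]; apply/eqP.
  (* The second map is nonzero: its signed column sum at [rowc] is 1. *)
  move=> hom2_0; have := hom_u0 _ t2; rewrite hom2_0 zero_lfunE linear0 inducedE.
  move/esym/altsum0/(_ rowc); rewrite val0 adm0 //.
  by apply/eqP/oner_neq0.
(* At [w1] the signed column sum is 1 for [t = n] and 0 for [t = 2], so the first map is no multiple
   of the second. *)
move=> homE; have := hom_u0 _ tn;
  rewrite homE scale_lfunE linearZ /= (hom_u0 _ t2) => /esym/eqP.
rewrite -subr_eq0 !inducedE -linearZ -linearB /= -linearZ -linearB =>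
  /eqP/altsum0/(_ w1).
rewrite altsum_lincomb !val1 adm1n (negbTE adm12) mulr0 subr0.
by apply/eqP/oner_neq0.
Qed.
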